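(* Let $A=\varinjlim(A_i,\varphi_i)$ be an AH algebra, where $A_i=\bigoplus_{t=1}^{k_i}M_{n_{it}}(C(X_{it}))$, the $X_{it}$ are connected compact Hausdorff spaces and $\varphi_i\colon A_i\to A_{i+1}$ are $*$-homomorphisms. Then the following are equivalent: (i) $A$ has the LP property; (ii) for every $i$, every $f\in\bigcup_{t=1}^{k_i}C(X_{it})$ and every $\varepsilon>0$, there is an integer $j\ge i$ such that $\varphi_{ij}(f)$ can be approximated by an element of $L(A_j)$ to within $\varepsilon$.
   Context: For a $C^*$-algebra $D$, $L(D)$ denotes the norm closure of the set of all (finite) linear combinations of projections of $D$. $D$ has the LP property if the linear span of its projections is dense in $D$, i.e. $L(D)=D$. $\varphi_{ij}\colon A_i\to A_j$ $(j\ge i)$ is the composed connecting map. A function $f\in C(X_{it})$ is regarded as the element $\mathrm{diag}(f,0)$ of the summand $M_{n_{it}}(C(X_{it}))$ of $A_i$ (non-unital embedding). *)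

(* Defs.v *)
From HB Require Import structures.
From mathcomp Require Import all_boot all_order all_algebra.
From mathcomp Require Import all_classical all_reals topology normedtype.
From mathcomp Require Import complex ring lra.
Set Implicit Arguments. Unset Strict Implicit. Unset Printing Implicit Defensive.
Import Order.TTheory GRing.Theory Num.Theory ComplexField Normc.
Import numFieldNormedType.Exports.
Local Open Scope classical_set_scope.
Local Open Scope ring_scope.
Local Open Scope complex_scope.

HB.instance Definition _ (R : realType) := NormedModule.copy R[i] R[i]^o.

(** C*-algebras are not assumed to be unital, so the product is not a MathComp
    ring product. *)
HB.mixin Record CompleteNormedModule_isCStarAlgebra (R : realType) (A : Type)
    & CompleteNormedModule R[i] A := {
  cmul : A -> A -> A;
  cstar : A -> A;
  cmulA : associative cmul;
  cmulDl : left_distributive cmul +%R;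
  cmulDr : right_distributive cmul +%R;
  cmulZl : forall (k : R[i]) (x y : A), cmul (k *: x) y = k *: cmul x y;
  cmulZr : forall (k : R[i]) (x y : A), cmul x (k *: y) = k *: cmul x y;
  cstarK : involutive cstar;
  cstarD : {morph cstar : x y / x + y};
  cstarZ : forall (k : R[i]) (x : A), cstar (k *: x) = k^* *: cstar x;
  cstarM : forall x y : A, cstar (cmul x y) = cmul (cstar y) (cstar x);
  cnormM : forall x y : A, `|cmul x y| <= `|x| * `|y|;
  cnorm_star : forall x : A, `|cmul (cstar x) x| = `|x| ^+ 2
}.

#[short(type="cstarAlgType")]
HB.structure Definition CStarAlgebra (R : realType) :=
  {A of CompleteNormedModule R[i] A & CompleteNormedModule_isCStarAlgebra R A}.

Arguments cmul {R A} x y : rename.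
Arguments cstar {R A} x : rename.

Definition star_hom (R : realType) (D E : cstarAlgType R) (f : D -> E) :=
  [/\ linear f, {morph f : x y / cmul x y >-> cmul x y}
    & {morph f : x / cstar x >-> cstar x}].

Definition is_projection (R : realType) (D : cstarAlgType R) (p : D) :=
  cstar p = p /\ cmul p p = p.

Definition projection_span (R : realType) (D : cstarAlgType R) : set D :=
  [set x | exists (m : nat) (c : 'I_m -> R[i]) (p : 'I_m -> D),
     (forall l, is_projection (p l)) /\ x = \sum_(l < m) c l *: p l].

Definition L (R : realType) (D : cstarAlgType R) : set D :=
  closure (@projection_span R D).
Arguments L {R} D.

Definition LP_property (R : realType) (D : cstarAlgType R) := L D = [set: D].

(** [connecting phi m] is the composed map from [A i] to [A (m + i)]. *)
Fixpoint connecting (T : nat -> Type) (phi : forall i, T i -> T i.+1) (i m : nat) :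
    T i -> T (m + i)%N :=
  match m with
  | 0 => fun a => a
  | m'.+1 => fun a => phi (m' + i)%N (connecting phi m' a)
  end.

(** The inductive limit of C*-algebras is the completion of the algebraic
    direct limit (the union of the images of the [A i]) for the C*-seminorm
    whose value at the class of [a : A i] is the limit of the norms of the
    images of [a] in the later algebras. *)
Definition is_inductive_limit (R : realType) (A : nat -> cstarAlgType R)
    (phi : forall i, A i -> A i.+1) (B : cstarAlgType R)
    (psi : forall i, A i -> B) :=
  [/\ forall i, star_hom (psi i),
      forall i a, psi i.+1 (phi i a) = psi i a,
      forall i (a : A i),
        (fun m => `|connecting phi m a|) @ \oo --> (`|psi i a| : R[i])
    & closure (\bigcup_i range (psi i)) = [set: B]].

Record compactHausdorff := CompactHausdorff {
  space :> topologicalType;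
  space_compact : compact [set: space];
  space_hausdorff : hausdorff_space space
}.

Section Cont.
Variables (R : realType) (X : topologicalType).
Local Notation CX := (continuousType X R[i]).
Implicit Types f g h : CX.

Definition mkC (f : X -> R[i]) (cf : continuous f) : CX := mkcts cf.

Let add_cts f g : continuous (fun x => f x + g x).
Proof. by move=> x; apply: cvgD; apply: cts_fun. Qed.
Let opp_cts f : continuous (fun x => - f x).
Proof. by move=> x; apply: cvgN; apply: cts_fun. Qed.
Let mul_cts f g : continuous (fun x => f x * g x).
Proof. by move=> x; apply: (@cvgM R[i]); apply: cts_fun. Qed.
Let cst_cts (k : R[i]) : continuous (fun _ : X => k).
Proof. by move=> x; apply: cvg_cst. Qed.
Let scale_cts (k : R[i]) f : continuous (fun x => k * f x).
Proof. by move=> x; apply: (@cvgM R[i]); [apply: cvg_cst|apply: cts_fun]. Qed.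
Let conj_cts f : continuous (fun x => (f x)^*).
Proof.
move=> x; apply/cvgrPdist_lt => e e0.
have /cvgrPdist_lt/(_ e e0) : f y @[y --> x] --> f x by apply: cts_fun.
by apply: filterS => y; rewrite -rmorphB normcJ.
Qed.

Let addC f g := mkC (@add_cts f g).
Let oppC f := mkC (@opp_cts f).
Let mulC f g := mkC (@mul_cts f g).
Definition conjC_cts f : CX := mkC (@conj_cts f).

Let addCA : associative addC.
Proof. by move=> f g h; apply/continuousEP => x; apply: addrA. Qed.
Let addCC : commutative addC.
Proof. by move=> f g; apply/continuousEP => x; apply: addrC. Qed.
Let add0C : left_id (mkC (@cst_cts 0)) addC.
Proof. by move=> f; apply/continuousEP => x; apply: add0r. Qed.
Let addNC : left_inverse (mkC (@cst_cts 0)) oppC addC.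
Proof. by move=> f; apply/continuousEP => x; apply: addNr. Qed.
HB.instance Definition _ := GRing.isZmodule.Build CX addCA addCC add0C addNC.

Let mulCA : associative mulC.
Proof. by move=> f g h; apply/continuousEP => x; apply: mulrA. Qed.
Let mulCC : commutative mulC.
Proof. by move=> f g; apply/continuousEP => x; apply: mulrC. Qed.
Let mul1C : left_id (mkC (@cst_cts 1)) mulC.
Proof. by move=> f; apply/continuousEP => x; apply: mul1r. Qed.
Let mulCDl : left_distributive mulC +%R.
Proof. by move=> f g h; apply/continuousEP => x; apply: mulrDl. Qed.
HB.instance Definition _ :=
  GRing.Zmodule_isComPzRing.Build CX mulCA mulCC mul1C mulCDl.

Let scaleC k f := mkC (@scale_cts k f).
Let scaleCA a b f : scaleC a (scaleC b f) = scaleC (a * b) f.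
Proof. by apply/continuousEP => x; apply: mulrA. Qed.
Let scale1C : left_id 1 scaleC.
Proof. by move=> f; apply/continuousEP => x; apply: mul1r. Qed.
Let scaleCDr : right_distributive scaleC +%R.
Proof. by move=> k f g; apply/continuousEP => x; apply: mulrDr. Qed.
Let scaleCDl f : {morph scaleC^~ f : a b / a + b}.
Proof. by move=> a b; apply/continuousEP => x; apply: mulrDl. Qed.
HB.instance Definition _ := GRing.Zmodule_isLmodule.Build R[i] CX
  scaleCA scale1C scaleCDr scaleCDl.

Lemma cts0E x : (0 : CX) x = 0. Proof. by []. Qed.
Lemma ctsDE f g x : (f + g) x = f x + g x. Proof. by []. Qed.
Lemma ctsNE f x : (- f) x = - f x. Proof. by []. Qed.
Lemma ctsME f g x : (f * g) x = f x * g x. Proof. by []. Qed.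
Lemma ctsZE k f x : (k *: f) x = k * f x. Proof. by []. Qed.
Lemma cts_sumE (I : Type) (r : seq I) (P : pred I) (F : I -> CX) x :
  (\sum_(l <- r | P l) F l) x = \sum_(l <- r | P l) F l x.
Proof. by elim/big_rec2: _ => // l y f _ <-. Qed.
End Cont.

Section OpNorm.
Variable R : realType.
Local Notation C := R[i].

Definition l2norm n (v : 'cV[C]_n) : R := Num.sqrt (\sum_i normc (v i 0) ^+ 2).

Definition opnorm n (M : 'M[C]_n) : R :=
  sup [set l2norm (M *m v) | v in [set v | l2norm v <= 1]].

Lemma normc_ge0 (z : C) : 0 <= normc z.
Proof. by case: z => a b; apply: sqrtr_ge0. Qed.

Lemma normcE (z : C) : (normc z)%:C = `|z|. Proof. by []. Qed.

Lemma normcK (z : C) : normc (z^*) = normc z.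
Proof. by apply: complexI; rewrite !normcE normcJ. Qed.

Lemma normc_sqr (z : C) : (normc z ^+ 2)%:C = z^* * z.
Proof. by rewrite rmorphXn /= normcE sqr_normc mulrC. Qed.

Lemma normc_sum (I : Type) (r : seq I) (F : I -> C) :
  normc (\sum_(l <- r) F l) <= \sum_(l <- r) normc (F l).
Proof.
elim/big_rec2: _ => [|l y f _ h]; first by rewrite normc0.
by rewrite (le_trans (le_normcD _ _))// lerD2l.
Qed.

Lemma sum_sqr_ge0 n (v : 'I_n -> R) : 0 <= \sum_i v i ^+ 2.
Proof. by apply: sumr_ge0 => i _; apply: sqr_ge0. Qed.

Lemma cauchy_schwarz n (a b : 'I_n -> R) :
  (\sum_i a i * b i) ^+ 2 <= (\sum_i a i ^+ 2) * (\sum_i b i ^+ 2).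
Proof.
have h : 0 <= \sum_i \sum_j (a i * b j - a j * b i) ^+ 2.
  by apply: sumr_ge0 => i _; apply: sumr_ge0 => j _; apply: sqr_ge0.
suff e : \sum_i \sum_j (a i * b j - a j * b i) ^+ 2 =
    ((\sum_i a i ^+ 2) * (\sum_i b i ^+ 2) - (\sum_i a i * b i) ^+ 2) *+ 2.
  by move: h; rewrite e pmulrn_lge0// subr_ge0.
have e i j : (a i * b j - a j * b i) ^+ 2 = a i ^+ 2 * b j ^+ 2
    + a j ^+ 2 * b i ^+ 2 - (a i * b i * (a j * b j)) *+ 2 by ring.
under eq_bigr do under eq_bigr do rewrite e.
under eq_bigr do rewrite !big_split /= -mulr_sumr -mulr_suml sumrN sumrMnl -mulr_sumr.
rewrite !big_split /= -mulr_suml -mulr_sumr sumrN sumrMnl -mulr_suml; ring.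
Qed.

Lemma l2norm_ge0 n (v : 'cV[C]_n) : 0 <= l2norm v.
Proof. exact: sqrtr_ge0. Qed.

Lemma l2norm_sqr n (v : 'cV[C]_n) :
  l2norm v ^+ 2 = \sum_i normc (v i 0) ^+ 2.
Proof. by rewrite sqr_sqrtr// sum_sqr_ge0. Qed.

Lemma l2norm_leP n (v : 'cV[C]_n) (c : R) : 0 <= c ->
  \sum_i normc (v i 0) ^+ 2 <= c ^+ 2 -> l2norm v <= c.
Proof.
by move=> c0 h; rewrite -(@ler_pXn2r _ 2)// ?nnegrE ?l2norm_ge0// l2norm_sqr.
Qed.

Lemma l2norm0 n : l2norm (0 : 'cV[C]_n) = 0.
Proof.
by rewrite /l2norm big1 ?sqrtr0// => i _; rewrite mxE normc0 expr0n.
Qed.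

Lemma l2normZ n (k : C) (v : 'cV[C]_n) : l2norm (k *: v) = normc k * l2norm v.
Proof.
apply/eqP; rewrite -(@eqrXn2 _ 2)// ?mulr_ge0 ?l2norm_ge0 ?normc_ge0//.
rewrite exprMn !l2norm_sqr mulr_sumr; apply/eqP/eq_bigr => i _.
by rewrite mxE normcM exprMn.
Qed.

Lemma l2normD n (u v : 'cV[C]_n) : l2norm (u + v) <= l2norm u + l2norm v.
Proof.
apply: l2norm_leP; first by rewrite addr_ge0 ?l2norm_ge0.
have cs : \sum_i normc (u i 0) * normc (v i 0) <= l2norm u * l2norm v.
  rewrite -(@ler_pXn2r _ 2)// ?nnegrE ?mulr_ge0 ?l2norm_ge0//; last first.
    by apply: sumr_ge0 => i _; rewrite mulr_ge0 ?normc_ge0.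
  by rewrite exprMn !l2norm_sqr cauchy_schwarz.
apply: (@le_trans _ _ (\sum_i (normc (u i 0) + normc (v i 0)) ^+ 2)).
  apply: ler_sum => i _; rewrite ler_pXn2r ?nnegrE ?addr_ge0 ?normc_ge0// mxE.
  exact: le_normcD.
under eq_bigr do rewrite sqrrD.
rewrite !big_split /= sqrrD !l2norm_sqr lerD2r lerD2l.
by rewrite mulr2n lerD.
Qed.

Lemma normc_le_l2norm n (v : 'cV[C]_n) i : normc (v i 0) <= l2norm v.
Proof.
rewrite -(@ler_pXn2r _ 2)// ?nnegrE ?l2norm_ge0 ?normc_ge0// l2norm_sqr.
by rewrite (bigD1 i)//= lerDl sumr_ge0// => j _; apply: sqr_ge0.
Qed.

Lemma l2norm_eq0 n (v : 'cV[C]_n) : l2norm v = 0 -> v = 0.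
Proof.
move=> h; apply/matrixP => i j; rewrite ord1 mxE.
apply: eq0_normc; apply/eqP; rewrite eq_le normc_ge0 andbT -h.
exact: normc_le_l2norm.
Qed.

Lemma l2norm_delta n (i : 'I_n) : l2norm (delta_mx i 0) = 1.
Proof.
rewrite /l2norm (bigD1 i)//= big1 ?addr0 => [|j ji]; rewrite !mxE eqxx.
  by rewrite eqxx normc1 expr1n sqrtr1.
by rewrite (negbTE ji) normc0 expr0n.
Qed.

Lemma l2norm_sum n (I : Type) (r : seq I) (F : I -> 'cV[C]_n) :
  l2norm (\sum_(l <- r) F l) <= \sum_(l <- r) l2norm (F l).
Proof.
elim/big_rec2: _ => [|l y f _ h]; first by rewrite l2norm0.
by rewrite (le_trans (l2normD _ _))// lerD2l.
Qed.

Lemma l2norm_le_sum n (v : 'cV[C]_n) : l2norm v <= \sum_i normc (v i 0).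
Proof.
have {1}-> : v = \sum_i (v i 0) *: delta_mx i 0.
  apply/matrixP => i j; rewrite ord1 summxE (bigD1 i)//= big1 => [|k ki].
    by rewrite !mxE !eqxx mulr1 addr0.
  by rewrite !mxE eq_sym (negbTE ki) mulr0.
apply: (le_trans (l2norm_sum _ _)); apply: ler_sum => i _.
by rewrite l2normZ l2norm_delta mulr1.
Qed.

Definition dot n (u v : 'cV[C]_n) : C := \sum_i (u i 0)^* * v i 0.

Lemma dotvv n (v : 'cV[C]_n) : dot v v = (l2norm v ^+ 2)%:C.
Proof.
rewrite l2norm_sqr rmorph_sum; apply: eq_bigr => i _.
by rewrite /= normc_sqr.
Qed.

Lemma dot_le n (u v : 'cV[C]_n) : normc (dot u v) <= l2norm u * l2norm v.
Proof.
apply: (le_trans (normc_sum _ _)).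
under eq_bigr do rewrite normcM normcK.
rewrite -(@ler_pXn2r _ 2)// ?nnegrE ?mulr_ge0 ?l2norm_ge0//; last first.
  by apply: sumr_ge0 => i _; rewrite mulr_ge0 ?normc_ge0.
by rewrite exprMn !l2norm_sqr cauchy_schwarz.
Qed.

Definition adjm n (M : 'M[C]_n) : 'M[C]_n := \matrix_(i, j) (M j i)^*.

Lemma dot_adj n (M : 'M[C]_n) (u v : 'cV[C]_n) :
  dot u (adjm M *m v) = dot (M *m u) v.
Proof.
rewrite /dot; under eq_bigr do rewrite mxE mulr_sumr.
under [RHS]eq_bigr do rewrite mxE rmorph_sum /= mulr_suml.
rewrite exchange_big /=; apply: eq_bigr => i _; apply: eq_bigr => j _.
by rewrite mxE rmorphM /= mulrA; congr (_ * _); rewrite mulrC.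
Qed.

Lemma l2norm_mul_le n (M : 'M[C]_n) (v : 'cV[C]_n) :
  l2norm (M *m v) <= (\sum_i \sum_j normc (M i j)) * l2norm v.
Proof.
apply: (le_trans (l2norm_le_sum _)); rewrite mulr_suml; apply: ler_sum => i _.
rewrite mxE (le_trans (normc_sum _ _))// mulr_suml; apply: ler_sum => j _.
by rewrite normcM ler_wpM2l ?normc_ge0 ?normc_le_l2norm.
Qed.

Lemma opnorm_has_sup n (M : 'M[C]_n) :
  has_sup [set l2norm (M *m v) | v in [set v | l2norm v <= 1]].
Proof.
split; first by exists (l2norm (M *m 0)); exists 0 => //=; rewrite l2norm0.
exists (\sum_i \sum_j normc (M i j)) => _ [v /= v1 <-].
apply: (le_trans (l2norm_mul_le _ _)); rewrite ler_piMr//.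
by apply: sumr_ge0 => i _; apply: sumr_ge0 => j _; apply: normc_ge0.
Qed.

Lemma opnorm_ge0 n (M : 'M[C]_n) : 0 <= opnorm M.
Proof.
have [_ ub] := opnorm_has_sup M.
have := ub_le_sup ub; apply; exists 0; rewrite /= ?l2norm0//.
by rewrite mulmx0 l2norm0.
Qed.

Lemma opnormP n (M : 'M[C]_n) (v : 'cV[C]_n) :
  l2norm (M *m v) <= opnorm M * l2norm v.
Proof.
have [/l2norm_eq0->|v0] := eqVneq (l2norm v) 0.
  by rewrite mulmx0 l2norm0 mulr0.
have vp : 0 < l2norm v by rewrite lt_neqAle eq_sym v0 l2norm_ge0.
rewrite -ler_pdivrMr//.
have [_ ub] := opnorm_has_sup M; apply: (ub_le_sup ub).
have nk : normc ((l2norm v)^-1%:C) = (l2norm v)^-1.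
  by apply: complexI; rewrite normcE ger0_norm ?ler0c ?invr_ge0// ltW.
exists ((l2norm v)^-1%:C *: v); rewrite /= ?l2normZ ?nk ?mulVf//.
by rewrite -scalemxAr l2normZ nk mulrC.
Qed.

Lemma opnorm_le n (M : 'M[C]_n) c : 0 <= c ->
  (forall v, l2norm (M *m v) <= c * l2norm v) -> opnorm M <= c.
Proof.
move=> c0 h; apply: ge_sup; first by case: (opnorm_has_sup M).
by move=> _ [v /= v1 <-]; rewrite (le_trans (h v))// ler_piMr.
Qed.

Lemma opnorm_le_sum n (M : 'M[C]_n) : opnorm M <= \sum_i \sum_j normc (M i j).
Proof.
apply: opnorm_le (l2norm_mul_le M).
by apply: sumr_ge0 => i _; apply: sumr_ge0 => j _; apply: normc_ge0.
Qed.

Lemma normc_le_opnorm n (M : 'M[C]_n) i j : normc (M i j) <= opnorm M.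
Proof.
have := opnormP M (delta_mx j 0); rewrite l2norm_delta mulr1; apply: le_trans.
have := normc_le_l2norm (M *m delta_mx j 0) i.
by rewrite -colE mxE.
Qed.

Lemma opnorm0 n : opnorm (0 : 'M[C]_n) = 0.
Proof.
apply/eqP; rewrite eq_le opnorm_ge0 andbT; apply: opnorm_le => // v.
by rewrite mul0mx l2norm0 mul0r.
Qed.

Lemma opnormD n (M N : 'M[C]_n) : opnorm (M + N) <= opnorm M + opnorm N.
Proof.
apply: opnorm_le => [|v]; first by rewrite addr_ge0 ?opnorm_ge0.
by rewrite mulmxDl mulrDl (le_trans (l2normD _ _))// lerD ?opnormP.
Qed.

Lemma opnormZ_le n k (M : 'M[C]_n) : opnorm (k *: M) <= normc k * opnorm M.
Proof.
apply: opnorm_le => [|v]; first by rewrite mulr_ge0 ?opnorm_ge0 ?normc_ge0.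
by rewrite -scalemxAl l2normZ -mulrA ler_wpM2l ?normc_ge0 ?opnormP.
Qed.

Lemma opnormM n (M N : 'M[C]_n) : opnorm (M *m N) <= opnorm M * opnorm N.
Proof.
apply: opnorm_le => [|v]; first by rewrite mulr_ge0 ?opnorm_ge0.
rewrite -mulmxA (le_trans (opnormP _ _))// -mulrA.
by rewrite ler_wpM2l ?opnorm_ge0 ?opnormP.
Qed.

Lemma opnorm_star_ge n (M : 'M[C]_n) :
  opnorm M ^+ 2 <= opnorm (adjm M *m M).
Proof.
have s0 := opnorm_ge0 (adjm M *m M).
rewrite -(sqr_sqrtr s0) ler_pXn2r ?nnegrE ?opnorm_ge0 ?sqrtr_ge0//.
apply: opnorm_le => [|v]; first exact: sqrtr_ge0.
rewrite -(@ler_pXn2r _ 2)// ?nnegrE ?mulr_ge0 ?sqrtr_ge0 ?l2norm_ge0//.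
rewrite exprMn (sqr_sqrtr s0).
have -> : l2norm (M *m v) ^+ 2 = normc (dot v (adjm M *m M *m v)).
  apply: complexI; rewrite -mulmxA dot_adj dotvv normcE ger0_norm//.
  by rewrite ler0c sqr_ge0.
rewrite (le_trans (dot_le _ _))// expr2 mulrCA ler_wpM2l ?l2norm_ge0//.
by rewrite opnormP.
Qed.

Lemma opnorm_adj_le n (M : 'M[C]_n) : opnorm (adjm M) <= opnorm M.
Proof.
have adjK : adjm (adjm M) = M.
  by apply/matrixP => i j; rewrite !mxE; apply: conjcK.
have h := le_trans (opnorm_star_ge (adjm M)) (opnormM _ _).
rewrite adjK expr2 in h.
have := opnorm_ge0 (adjm M); rewrite le_eqVlt => /orP[/eqP<-|p].
  exact: opnorm_ge0.
by rewrite -(ler_pM2r p).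
Qed.

End OpNorm.

Lemma complex_complete (R : realType) (F : set_system R[i]) :
  ProperFilter F -> cauchy F -> cvg F.
Proof.
move=> FF /cauchy_ballP Fc.
have part (f : R[i] -> R) : (forall z w, `|f z - f w|%:C <= `|z - w|) ->
    exists l : R, f @ F --> l.
  move=> fl; suff : cvg (f @ F) by move=> ?; exists (lim (f @ F)).
  apply: R_complete; apply/cauchy_ballP => e e0.
  have eC0 : 0 < e%:C by rewrite ltcR.
  have [[A B] /= [FA FB] AB] := Fc _ eC0.
  exists (f @` A, f @` B); first by split => /=;
    [apply: filterS FA|apply: filterS FB] => z ?; exists z.
  move=> [_ _] [/= [z Az <-] [w Bw <-]].
  have := AB (z, w) (conj Az Bw); rewrite /= -!ball_normE /ball_ /=.
  by rewrite -ltcR; apply: le_lt_trans.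
have Re_le (z w : R[i]) : `|complex.Re z - complex.Re w|%:C <= `|z - w|.
  by have := normc_ge_Re (z - w); rewrite raddfB.
have Im_le (z w : R[i]) : `|complex.Im z - complex.Im w|%:C <= `|z - w|.
  case: z w => [a b] [c d] /=; rewrite lecR /normc /=.
  by rewrite -sqrtr_sqr ler_wsqrtr// lerDr sqr_ge0.
have [a Fa] := part _ Re_le; have [b Fb] := part _ Im_le.
apply/cvg_ex; exists (a +i* b); apply/cvgrPdist_lt => e e0.
have ee : e = (complex.Re e)%:C by rewrite RRe_real// gtr0_real.
have e20 : 0 < complex.Re e / 2 by rewrite divr_gt0// -ltcR -ee.
move/cvgrPdist_lt/(_ _ e20) : Fa; move/cvgrPdist_lt/(_ _ e20) : Fb.
apply: filterS2 => -[c d] /= hb ha.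
have -> : (a +i* b) - (c +i* d) = (a - c)%:C + (0 +i* (b - d)).
  by apply/eqP; rewrite eq_complex /= addr0 add0r !eqxx.
rewrite (le_lt_trans (ler_normD _ _))// ee [ltRHS](_ : _ =
  (complex.Re e / 2)%:C + (complex.Re e / 2)%:C); last first.
  by rewrite -rmorphD -splitr.
have nr (r : R) : normc r%:C = `|r| by rewrite /normc /= expr0n addr0 sqrtr_sqr.
have ni (r : R) : normc (0 +i* r) = `|r| by rewrite /normc /= expr0n add0r sqrtr_sqr.
by rewrite ltrD// -normcE ltcR ?nr ?ni.
Qed.

HB.instance Definition _ (R : realType) :=
  Uniform_isComplete.Build R[i] (@complex_complete R).

(** The C*-algebra [\bigoplus_(t < k) M_(n t)(C(X t))]; [X t] comes bundled with
    its compactness, without which [msum_norm] below would not be a norm. *)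
Definition matrix_sum (R : realType) (k : nat) (n : 'I_k -> nat)
    (X : 'I_k -> compactHausdorff) : Type :=
  forall t : 'I_k, 'M[continuousType (X t) R[i]]_(n t).

Section MatrixSum.
Variables (R : realType) (k : nat) (n : 'I_k -> nat).
Variable X : 'I_k -> compactHausdorff.
Local Notation C := R[i].
Local Notation S := (matrix_sum R n X).
Implicit Types a b c : S.

Definition fiber a t (x : X t) : 'M[C]_(n t) := \matrix_(i, j) a t i j x.

(** The supremum over all points of all the spaces of the operator norm on
    complex Euclidean space; it is [0] when every [X t] is empty. *)
Definition msum_norm a : R :=
  sup [set r | exists t (x : X t), r = opnorm (fiber a x)].

Definition msum_mul a b : S := fun t => a t *m b t.
Definition msum_star a : S := fun t => \matrix_(i, j) conjC_cts (a t j i).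

Lemma msumP a b : (forall t i j x, a t i j x = b t i j x) -> a = b.
Proof.
move=> h; apply: functional_extensionality_dep => t; apply/matrixP => i j.
by apply/continuousEP => x; apply: h.
Qed.

Let add a b : S := fun t => a t + b t.
Let opp a : S := fun t => - a t.
Let zero : S := fun t => 0.
Let scale (z : C) a : S := fun t => \matrix_(i, j) (z *: a t i j).

HB.instance Definition _ := gen_eqMixin S.
HB.instance Definition _ := gen_choiceMixin S.

Let addA : associative add.
Proof. by move=> a b c; apply: functional_extensionality_dep => t; apply: addrA. Qed.
Let addC : commutative add.
Proof. by move=> a b; apply: functional_extensionality_dep => t; apply: addrC. Qed.
Let add0 : left_id zero add.
Proof. by move=> a; apply: functional_extensionality_dep => t; apply: add0r. Qed.
Let addN : left_inverse zero opp add.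
Proof. by move=> a; apply: functional_extensionality_dep => t; apply: addNr. Qed.
HB.instance Definition _ := GRing.isZmodule.Build S addA addC add0 addN.

Let scaleA y z a : scale y (scale z a) = scale (y * z) a.
Proof. by apply: msumP => t i j x; rewrite !mxE scalerA. Qed.
Let scale1 : left_id 1 scale.
Proof. by move=> a; apply: msumP => t i j x; rewrite mxE scale1r. Qed.
Let scaleDr : right_distributive scale +%R.
Proof. by move=> z a b; apply: msumP => t i j x; rewrite !mxE scalerDr. Qed.
Let scaleDl a : {morph scale^~ a : y z / y + z}.
Proof. by move=> y z; apply: msumP => t i j x; rewrite !mxE scalerDl. Qed.
HB.instance Definition _ :=
  GRing.Zmodule_isLmodule.Build C S scaleA scale1 scaleDr scaleDl.

Lemma msumDE a b t i j x : (a + b) t i j x = a t i j x + b t i j x.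
Proof. by rewrite mxE. Qed.
Lemma msumNE a t i j x : (- a) t i j x = - a t i j x.
Proof. by rewrite mxE. Qed.
Lemma msumZE z a t i j x : (z *: a) t i j x = z * a t i j x.
Proof. by rewrite mxE. Qed.
Lemma msum_mulE a b t i j x :
  msum_mul a b t i j x = \sum_l a t i l x * b t l j x.
Proof. by rewrite mxE cts_sumE. Qed.
Lemma msum_starE a t i j x : msum_star a t i j x = (a t j i x)^*.
Proof. by rewrite mxE. Qed.

Lemma fiberD a b t (x : X t) : fiber (a + b) x = fiber a x + fiber b x.
Proof. by apply/matrixP => i j; rewrite !mxE. Qed.
Lemma fiberZ z a t (x : X t) : fiber (z *: a) x = z *: fiber a x.
Proof. by apply/matrixP => i j; rewrite !mxE. Qed.
Lemma fiberM a b t (x : X t) : fiber (msum_mul a b) x = fiber a x *m fiber b x.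
Proof.
apply/matrixP => i j; rewrite !mxE cts_sumE; apply: eq_bigr => l _.
by rewrite !mxE.
Qed.
Lemma fiber_star a t (x : X t) : fiber (msum_star a) x = adjm (fiber a x).
Proof. by apply/matrixP => i j; rewrite !mxE. Qed.

Lemma normc_dist_le (z w : C) : `|normc z - normc w| <= normc (z - w).
Proof.
have h (y1 y2 : C) : normc y1 - normc y2 <= normc (y1 - y2).
  by rewrite lerBlDr -[y1 in leLHS](subrK y2) le_normcD.
rewrite ler_norml h andbT lerNl opprB.
by rewrite (le_trans (h w z))// -normcN opprB.
Qed.

Lemma cts_bounded (Y : compactHausdorff) (f : continuousType Y C) :
  exists M : R, 0 <= M /\ forall x, normc (f x) <= M.
Proof.
have ncts : continuous (fun y => normc (f y) : R).
  move=> y; apply/cvgrPdist_lt => e e0.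
  have eC0 : 0 < e%:C by rewrite ltcR.
  have /cvgrPdist_lt/(_ _ eC0) : f z @[z --> y] --> f y by apply: cts_fun.
  apply: filterS => z; rewrite -normcE ltcR; apply: le_lt_trans.
  exact: normc_dist_le.
have cK : compact ((fun y => normc (f y)) @` [set: Y]).
  apply: continuous_compact (@space_compact Y).
  exact: continuous_subspaceT.
have [M [_ hM]] := compact_bounded cK.
exists (`|M| + 1); split => [|x]; first by rewrite addr_ge0.
have M1 : M < `|M| + 1 by rewrite (le_lt_trans (ler_norm M))// ltrDl.
have /= h := hM _ M1 (normc (f x)).
have : `|normc (f x)| <= `|M| + 1 by apply: h; exists x.
by rewrite ger0_norm ?normc_ge0.
Qed.

Lemma fiber_bounded a : exists M : R, forall t (x : X t), opnorm (fiber a x) <= M.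
Proof.
have /choice[B hB] (s : {t : 'I_k & ('I_(n t) * 'I_(n t))%type}) :
    exists M : R, 0 <= M /\
      forall x, normc (a (tag s) (tagged s).1 (tagged s).2 x) <= M.
  exact: cts_bounded.
pose T t (i j : 'I_(n t)) := existT (fun t => ('I_(n t) * 'I_(n t))%type) t (i, j).
exists (\sum_t \sum_i \sum_j B (T t i j)).
move=> t x; rewrite (bigD1 t)//= ler_wpDr//.
  apply: sumr_ge0 => s _; apply: sumr_ge0 => i _; apply: sumr_ge0 => j _.
  by case: (hB (T s i j)).
apply: (le_trans (opnorm_le_sum _)).
apply: ler_sum => i _; apply: ler_sum => j _; rewrite mxE.
by case: (hB (T t i j)) => _; apply.
Qed.

Lemma fiber_le_norm a t (x : X t) : opnorm (fiber a x) <= msum_norm a.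
Proof.
apply: ub_le_sup; last by exists t, x.
by have [M hM] := fiber_bounded a; exists M => _ [s [y ->]].
Qed.

Lemma msum_norm_le a (c : R) : 0 <= c ->
  (forall t (x : X t), opnorm (fiber a x) <= c) -> msum_norm a <= c.
Proof.
move=> c0 h; rewrite /msum_norm; set A := [set _ | _].
have [A0|A0] := pselect (A !=set0).
  by apply: ge_sup => // _ [t [x ->]].
by rewrite (_ : A = set0) ?sup0//; apply/eqP/negPn/negP => /set0P.
Qed.

Lemma msum_norm_ge0 a : 0 <= msum_norm a.
Proof.
rewrite /msum_norm; set A := [set _ | _].
have [[r [t [x _]]]|A0] := pselect (A !=set0).
  exact: le_trans (opnorm_ge0 _) (fiber_le_norm a x).
by rewrite (_ : A = set0) ?sup0//; apply/eqP/negPn/negP => /set0P.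
Qed.

Lemma normc_le_msum a t i j (x : X t) : normc (a t i j x) <= msum_norm a.
Proof.
apply: le_trans (fiber_le_norm a x).
by have := normc_le_opnorm (fiber a x) i j; rewrite mxE.
Qed.

Let norm a : C := (msum_norm a)%:C.

Let normD a b : norm (a + b) <= norm a + norm b.
Proof.
suff : msum_norm (a + b) <= msum_norm a + msum_norm b.
  by rewrite -lecR rmorphD.
apply: msum_norm_le => [|t x].
  by rewrite addr_ge0 ?msum_norm_ge0.
by rewrite fiberD (le_trans (opnormD _ _))// lerD ?fiber_le_norm.
Qed.

Lemma msum_normZ_le z a : msum_norm (z *: a) <= normc z * msum_norm a.
Proof.
apply: msum_norm_le => [|t x]; first by rewrite mulr_ge0 ?msum_norm_ge0 ?normc_ge0.
rewrite fiberZ (le_trans (opnormZ_le _ _))// ler_wpM2l ?normc_ge0//.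
exact: fiber_le_norm.
Qed.

Let normZ z a : norm (z *: a) = `|z| * norm a.
Proof.
suff -> : norm (z *: a) = (normc z * msum_norm a)%:C by rewrite rmorphM.
congr (_%:C); apply/eqP.
rewrite eq_le msum_normZ_le /=.
have [->|z0] := eqVneq z 0; first by rewrite normc0 mul0r msum_norm_ge0.
have nz : 0 < normc z by rewrite -ltcR normcE normr_gt0.
rewrite -ler_pdivlMl// -[a in leLHS](scalerK z0) -normcV.
exact: msum_normZ_le.
Qed.

Let norm0_eq0 a : norm a = 0 -> a = 0.
Proof.
move=> /complexI h; apply: msumP => t i j x; rewrite mxE cts0E.
by apply: eq0_normc; apply/eqP; rewrite eq_le normc_ge0 andbT -h normc_le_msum.
Qed.

HB.instance Definition _ := Lmodule_isNormed.Build C S normD normZ norm0_eq0.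

Lemma msum_normE a : `|a| = (msum_norm a)%:C. Proof. by []. Qed.

Lemma entry_le a t i j (x : X t) : `|a t i j x| <= `|a|.
Proof. by rewrite -normcE msum_normE lecR normc_le_msum. Qed.

Lemma msum_norm_le_entries a (c : R) : 0 <= c ->
  (forall t i j (x : X t), normc (a t i j x) <= c) ->
  msum_norm a <= (\sum_t (n t * n t))%:R * c.
Proof.
move=> c0 h; apply: msum_norm_le => [|t x]; first by rewrite mulr_ge0.
apply: (@le_trans _ _ ((n t * n t)%:R * c)); last first.
  by rewrite ler_wpM2r// ler_nat (bigD1 t)//= leq_addr.
apply: (le_trans (opnorm_le_sum _)).
apply: (@le_trans _ _ (\sum_(i < n t) \sum_(j < n t) c)).
  by apply: ler_sum => i _; apply: ler_sum => j _; rewrite mxE.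
by rewrite !sumr_const !card_ord -mulrnA mulr_natl.
Qed.

Let msum_complete (F : set_system S) : ProperFilter F -> cauchy F -> cvg F.
Proof.
move=> FF Fc.
have FcB (e : R) : 0 < e -> exists a, F [set b | `|a - b| < e%:C].
  move=> e0; have eC0 : 0 < e%:C by rewrite ltcR.
  have /cauchyP/(_ _ eC0)[a Fa] := Fc.
  by exists a; apply: filterS Fa => b; rewrite -ball_normE.
have ex_lim t i j (x : X t) : exists l : C,
    (fun a : S => a t i j x) @ F --> l.
  suff : cvg ((fun a : S => a t i j x) @ F) by move=> ?; eexists; eassumption.
  apply: cauchy_cvg; apply/cauchy_ballP => e e0.
  have /cauchy_ballP/(_ _ e0)[[A B] /= [FA FB] AB] := Fc.
  exists ((fun a : S => a t i j x) @` A, (fun a : S => a t i j x) @` B).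
    by split => /=; [apply: filterS FA|apply: filterS FB] => z ?; exists z.
  move=> [_ _] [/= [z Az <-] [w Bw <-]].
  have := AB (z, w) (conj Az Bw); rewrite /= -!ball_normE /ball_ /=.
  by apply: le_lt_trans; have := entry_le (z - w) i j x; rewrite msumDE msumNE.
have /choice[g gP] (s : {t : 'I_k & ('I_(n t) * 'I_(n t) * X t)%type}) :
    exists l : C,
      (fun a : S => a (tag s) (tagged s).1.1 (tagged s).1.2 (tagged s).2) @ F --> l.
  exact: ex_lim.
pose T t (i j : 'I_(n t)) (x : X t) :=
  existT (fun t => ('I_(n t) * 'I_(n t) * X t)%type) t (i, j, x).
have close (e : R) a : F [set b | `|a - b| < e%:C] ->
    forall t i j (x : X t), normc (a t i j x - g (T t i j x)) <= e.
  move=> Fa t i j x; rewrite -lecR normcE.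
  apply/ler_addgt0Pr => d d0.
  have /cvgrPdist_lt/(_ _ d0) Fg := gP (T t i j x).
  have [b [/= ab bg]] := filter_ex (filterI Fa Fg).
  rewrite -[a t i j x](subrK (b t i j x)) -addrA (le_trans (ler_normD _ _))//.
  rewrite lerD//; last by rewrite distrC ltW.
  rewrite (le_trans _ (ltW ab))//.
  by have := entry_le (a - b) i j x; rewrite msumDE msumNE.
have gcts t i j : continuous (fun x : X t => g (T t i j x)).
  move=> x; apply/cvgrPdist_lt => e e0.
  have ee : e = (complex.Re e)%:C by rewrite RRe_real// gtr0_real.
  have e30 : 0 < complex.Re e / 3 by rewrite divr_gt0// -ltcR -ee.
  have [a /close aP] := FcB _ e30.
  have e3C : 0 < (complex.Re e / 3)%:C by rewrite ltcR.
  have /cvgrPdist_lt/(_ _ e3C) : a t i j y @[y --> x] --> a t i j x.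
    by apply: cts_fun.
  apply: filterS => y; rewrite -normcE ltcR => xy.
  rewrite -normcE ee ltcR.
  have -> : g (T t i j x) - g (T t i j y) =
      - (a t i j x - g (T t i j x)) + (a t i j x - a t i j y)
      + (a t i j y - g (T t i j y)) by ring.
  rewrite (le_lt_trans (le_normcD _ _))//.
  rewrite (@le_lt_trans _ _ (normc (a t i j x - g (T t i j x)) +
     normc (a t i j x - a t i j y) + normc (a t i j y - g (T t i j y))))//.
    by rewrite lerD2r (le_trans (le_normcD _ _))// normcN.
  have := aP _ i j x; have := aP _ i j y; lra.
pose G : S := fun t => \matrix_(i, j) mkC (gcts t i j).
apply/cvg_ex; exists G; apply/cvgrPdist_lt => e e0.
have ee : e = (complex.Re e)%:C by rewrite RRe_real// gtr0_real.
have er0 : 0 < complex.Re e by rewrite -ltcR -ee.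
pose K : R := (\sum_t (n t * n t))%:R.
have K0 : 0 <= K by rewrite ler0n.
pose d := complex.Re e / (K + 1 + 1).
have d0 : 0 < d by rewrite divr_gt0//; lra.
have [a Fa] := FcB _ d0.
apply: filterS (Fa) => b /= ab.
have Ga : `|G - a| <= (K * d)%:C.
  rewrite msum_normE lecR; apply: msum_norm_le_entries => [|t i j x].
    exact: ltW.
  rewrite msumDE msumNE mxE -normcN opprB.
  exact: close.
rewrite -[G](subrK a) -addrA (le_lt_trans (ler_normD _ _))//.
rewrite (@le_lt_trans _ _ ((K * d)%:C + d%:C))//; first by rewrite lerD// ltW.
rewrite -rmorphD ee ltcR.
have -> : complex.Re e = d * (K + 1 + 1) by rewrite /d divfK//; apply/eqP; lra.
lra.
Qed.

HB.instance Definition _ := Uniform_isComplete.Build S msum_complete.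

Let mulA : associative msum_mul.
Proof. by move=> a b c; apply: functional_extensionality_dep => t; apply: mulmxA. Qed.
Let mulDl : left_distributive msum_mul +%R.
Proof. by move=> a b c; apply: functional_extensionality_dep => t; apply: mulmxDl. Qed.
Let mulDr : right_distributive msum_mul +%R.
Proof. by move=> a b c; apply: functional_extensionality_dep => t; apply: mulmxDr. Qed.
Let mulZl z a b : msum_mul (z *: a) b = z *: msum_mul a b.
Proof.
apply: msumP => t i j x; rewrite msumZE !msum_mulE mulr_sumr.
by apply: eq_bigr => l _; rewrite msumZE mulrA.
Qed.
Let mulZr z a b : msum_mul a (z *: b) = z *: msum_mul a b.
Proof.
apply: msumP => t i j x; rewrite msumZE !msum_mulE mulr_sumr.
by apply: eq_bigr => l _; rewrite msumZE mulrCA.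
Qed.
Let starK : involutive msum_star.
Proof. by move=> a; apply: msumP => t i j x; rewrite !msum_starE; apply: conjcK. Qed.
Let starD : {morph msum_star : a b / a + b}.
Proof.
by move=> a b; apply: msumP => t i j x; rewrite msumDE !msum_starE msumDE rmorphD.
Qed.
Let starZ z a : msum_star (z *: a) = z^* *: msum_star a.
Proof.
by apply: msumP => t i j x; rewrite msumZE !msum_starE msumZE rmorphM.
Qed.
Let starM a b : msum_star (msum_mul a b) = msum_mul (msum_star b) (msum_star a).
Proof.
apply: msumP => t i j x; rewrite msum_starE !msum_mulE rmorph_sum /=.
by apply: eq_bigr => l _; rewrite !msum_starE rmorphM mulrC.
Qed.

Lemma msum_normM_le a b : msum_norm (msum_mul a b) <= msum_norm a * msum_norm b.
Proof.
apply: msum_norm_le => [|t x]; first by rewrite mulr_ge0 ?msum_norm_ge0.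
rewrite fiberM (le_trans (opnormM _ _))//.
by rewrite ler_pM ?opnorm_ge0 ?fiber_le_norm.
Qed.

Let normM_le a b : `|msum_mul a b| <= `|a| * `|b|.
Proof. by rewrite !msum_normE -rmorphM lecR msum_normM_le. Qed.

Lemma msum_norm_star a : msum_norm (msum_mul (msum_star a) a) = msum_norm a ^+ 2.
Proof.
apply/eqP; rewrite eq_le; apply/andP; split.
  apply: (le_trans (msum_normM_le (msum_star a) a)); rewrite [leRHS]expr2.
  apply: ler_wpM2r; first exact: msum_norm_ge0.
  apply: msum_norm_le => [|t x]; first exact: msum_norm_ge0.
  by rewrite fiber_star (le_trans (opnorm_adj_le _))// fiber_le_norm.
have s0 := msum_norm_ge0 (msum_mul (msum_star a) a).
rewrite -(sqr_sqrtr s0) ler_pXn2r ?nnegrE ?msum_norm_ge0 ?sqrtr_ge0//.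
apply: msum_norm_le => [|t x]; first exact: sqrtr_ge0.
rewrite -(@ler_pXn2r _ 2)// ?nnegrE ?sqrtr_ge0 ?opnorm_ge0// (sqr_sqrtr s0).
rewrite (le_trans (opnorm_star_ge _))// -fiber_star -fiberM.
exact: fiber_le_norm.
Qed.

Let norm_star a : `|msum_mul (msum_star a) a| = `|a| ^+ 2.
Proof. by rewrite !msum_normE msum_norm_star rmorphXn. Qed.

HB.instance Definition _ :=
  CompleteNormedModule_isCStarAlgebra.Build R S mulA mulDl mulDr mulZl mulZr
    starK starD starZ starM normM_le norm_star.

Definition diag0 (m : nat) (Y : topologicalType) (f : continuousType Y C) :
    'M[continuousType Y C]_m :=
  \matrix_(i, j) (if (i == 0 :> nat) && (j == 0 :> nat) then f else 0).

(** The element [diag(f, 0, ..., 0)] of the summand [M_(n t)(C(X t))]. *)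
Definition corner t (f : continuousType (X t) C) : S :=
  eqtype.dfwith (fun s => 0 : 'M[continuousType (X s) C]_(n s)) (diag0 (n t) f).

End MatrixSum.

(* Main.v *)
(** A *-homomorphism from a C*-algebra to [matrix_sum] is contractive: if it
    increased the norm of [a], then [1 - t a^* a], with [1/t] the norm of the
    image of [a^* a] in some fibre, would be invertible upstairs by a Neumann
    series, whereas downstairs its image almost kills the vectors on which the
    image of [a] almost attains its norm. Hence all maps [A i -> A] are contractive too.

    (i) => (ii): a projection of [A] is close to the image of a self-adjoint [b]
    of some [A i], and further along the sequence [b^2 - b] becomes small in
    norm, so that Newton's iteration moves [b] to a projection nearby. Thus linear
    combinations of projections of [A] lift approximately.

    (ii) => (i): the commutator of two projections is a combination of two
    projections, namely of the conjugates of one by the unitaries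
    [1 + (i - 1) q] and [1 + (- i - 1) q]. So the span of the projections is
    closed under commutators, and [L A] under commutators with this span. Every
    [f e_jl] is obtained from [diag(f, 0)] by commutators with constant matrix
    units, which are in the span of the projections. *)
Require Import Defs.
From mathcomp Require Import all_boot all_order all_algebra.
From mathcomp Require Import all_classical all_reals topology normedtype.
From mathcomp Require Import sequences complex ring lra.
Import Order.TTheory GRing.Theory Num.Theory numFieldNormedType.Exports.
Import ComplexField Normc.
Local Open Scope classical_set_scope.
Local Open Scope ring_scope.
Local Open Scope complex_scope.
Set Implicit Arguments.
Unset Strict Implicit.
Unset Printing Implicit Defensive.

Local Notation "x ** y" := (cmul x y) (at level 40, left associativity).

Lemma normc_realE (R : realType) (r : R) : normc r%:C = `|r|.
Proof. by rewrite /normc /= expr0n addr0 sqrtr_sqr. Qed.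

(** * Norm estimates and limits in a C*-algebra *)

Section CStarNorm.
Variables (R : realType) (D : cstarAlgType R).
Implicit Types (x y z p q : D) (k : R[i]).

(** The norm takes values in [R[i]]; its real part puts the estimates within reach of [lra] and
    [nra]. *)
Definition nrm x : R := complex.Re `|x|.

Lemma nrmE x : `|x| = (nrm x)%:C.
Proof. by rewrite RRe_real// normr_real. Qed.

Lemma nrm_ge0 x : 0 <= nrm x.
Proof. by rewrite -lecR -nrmE normr_ge0. Qed.

Lemma nrmD x y : nrm (x + y) <= nrm x + nrm y.
Proof. by rewrite -lecR rmorphD /= -!nrmE ler_normD. Qed.

Lemma nrm0 : nrm 0 = 0.
Proof. by rewrite /nrm normr0. Qed.

Lemma nrm0_eq0 x : nrm x = 0 -> x = 0.
Proof. by move=> h; apply/eqP; rewrite -normr_eq0 nrmE h. Qed.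

Lemma nrmN x : nrm (- x) = nrm x.
Proof. by rewrite /nrm normrN. Qed.

Lemma nrmB x y : nrm (x - y) = nrm (y - x).
Proof. by rewrite -nrmN opprB. Qed.

Lemma nrmZ k x : nrm (k *: x) = normc k * nrm x.
Proof. by apply: complexI; rewrite rmorphM /= -!nrmE Defs.normcE normrZ. Qed.

Lemma nrm_muln x m : nrm (x *+ m) <= nrm x *+ m.
Proof.
elim: m => [|m IH]; first by rewrite !mulr0n nrm0.
by rewrite !mulrS (le_trans (nrmD _ _))// lerD2l.
Qed.

Lemma nrmM x y : nrm (x ** y) <= nrm x * nrm y.
Proof. by rewrite -lecR rmorphM /= -!nrmE cnormM. Qed.

Lemma nrm_starM x : nrm (cstar x ** x) = nrm x ^+ 2.
Proof. by apply: complexI; rewrite rmorphXn /= -!nrmE cnorm_star. Qed.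

(** The C*-identity gives [nrm y ^+ 2 <= nrm (cstar y) * nrm y]; cancel [nrm y], then use this for
    [x] and for [cstar x]. *)
Lemma nrm_star x : nrm (cstar x) = nrm x.
Proof.
suff h y : nrm y <= nrm (cstar y).
  by apply/eqP; rewrite eq_le h andbT -[x in leRHS]cstarK h.
have := nrm_ge0 y; rewrite le_eqVlt => /orP[/eqP<-|y0]; first exact: nrm_ge0.
by rewrite -(ler_pM2r y0) -expr2 -nrm_starM nrmM.
Qed.

Lemma nrm_distD y x z : nrm (x - z) <= nrm (x - y) + nrm (y - z).
Proof. by rewrite -[in leLHS](subrK y x) -addrA nrmD. Qed.

Lemma nrm_le_dist y x : nrm x <= nrm y + nrm (x - y).
Proof. by rewrite -{1}[x](subrKC y) nrmD. Qed.

Lemma nrm_sum (I : Type) (r : seq I) (F : I -> D) :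
  nrm (\sum_(l <- r) F l) <= \sum_(l <- r) nrm (F l).
Proof.
elim/big_rec2: _ => [|l y f _ h]; first by rewrite nrm0.
by rewrite (le_trans (nrmD _ _))// lerD2l.
Qed.

Lemma cmul0l x : 0 ** x = 0.
Proof. by apply: (addrI (0 ** x)); rewrite -cmulDl !addr0. Qed.
Lemma cmul0r x : x ** 0 = 0.
Proof. by apply: (addrI (x ** 0)); rewrite -cmulDr !addr0. Qed.
Lemma cmulNl x y : (- x) ** y = - (x ** y).
Proof. by rewrite -scaleN1r cmulZl scaleN1r. Qed.
Lemma cmulNr x y : x ** (- y) = - (x ** y).
Proof. by rewrite -scaleN1r cmulZr scaleN1r. Qed.
Lemma cmulBl x y z : (x - y) ** z = x ** z - y ** z.
Proof. by rewrite cmulDl cmulNl. Qed.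
Lemma cmulBr x y z : x ** (y - z) = x ** y - x ** z.
Proof. by rewrite cmulDr cmulNr. Qed.
Lemma cmulMnl x y m : (x *+ m) ** y = (x ** y) *+ m.
Proof. by elim: m => [|m IH]; rewrite ?mulr0n ?cmul0l// !mulrS cmulDl IH. Qed.
Lemma cmulMnr x y m : x ** (y *+ m) = (x ** y) *+ m.
Proof. by elim: m => [|m IH]; rewrite ?mulr0n ?cmul0r// !mulrS cmulDr IH. Qed.
Lemma cstarN x : cstar (- x) = - cstar x.
Proof. by rewrite -scaleN1r cstarZ rmorphN1 scaleN1r. Qed.
Lemma cstar0 : cstar 0 = 0 :> D.
Proof. by apply: (addrI (cstar 0)); rewrite -cstarD !addr0. Qed.
Lemma cstarMn x m : cstar (x *+ m) = cstar x *+ m.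
Proof. by elim: m => [|m IH]; rewrite ?mulr0n ?cstar0// !mulrS cstarD IH. Qed.
Lemma cstarB x y : cstar (x - y) = cstar x - cstar y.
Proof. by rewrite cstarD cstarN. Qed.

Lemma closure_nrmP (S : set D) x :
  closure S x <-> forall e : R, 0 < e -> exists2 y, S y & nrm (x - y) < e.
Proof.
split=> [Sx e e0|h B /nbhs_ballP[e /= e0 eB]].
  have eC0 : 0 < e%:C by rewrite ltcR.
  have [y [Sy]] := Sx _ (nbhsx_ballx x _ eC0).
  by rewrite -ball_normE /ball_ /= nrmE ltcR => xy; exists y.
have ee : e = (complex.Re e)%:C by rewrite RRe_real// gtr0_real.
have [|y Sy xy] := h (complex.Re e); first by rewrite -ltcR -ee.
exists y; split=> //; apply: eB.
by rewrite -ball_normE /ball_ /= nrmE ee ltcR.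
Qed.

Lemma expr_lt_eventually (c r e : R) : 0 <= r < 1 -> 0 < e ->
  exists N, forall m, (N <= m)%N -> c * r ^+ m < e.
Proof.
move=> /andP[r0 r1] e0; have : (fun m => c * r ^+ m) @ \oo --> (0 : R).
  rewrite -[X in _ --> X](mulr0 c); apply: cvgMr; apply: cvg_expr.
  by rewrite ger0_norm.
move/cvgrPdist_lt/(_ _ e0) => [N _ hN]; exists N => m Nm.
by have := hN m Nm; rewrite /= sub0r normrN; apply/le_lt_trans/ler_norm.
Qed.

Lemma geometric_limit (u : nat -> D) (c r : R) : 0 <= r < 1 ->
  (forall m, nrm (u m.+1 - u m) <= c * r ^+ m) ->
  exists l, forall m, nrm (u m - l) <= c * r ^+ m / (1 - r).
Proof.
move=> r01 hu; have /andP[r0 r1] := r01; have r1p : 0 < 1 - r by rewrite subr_gt0.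
have c0 : 0 <= c by have := hu 0; rewrite expr0 mulr1; apply/le_trans/nrm_ge0.
have step m d : nrm (u m - u (d + m)%N) <= c * r ^+ m / (1 - r).
  (* The exact finite geometric sum is what the induction on [d] preserves. *)
  suff : nrm (u m - u (d + m)%N) <= c * r ^+ m * (1 - r ^+ d) / (1 - r).
    move/le_trans; apply; rewrite ler_wpM2r ?invr_ge0 ?(ltW r1p)//.
    by rewrite ler_piMr ?mulr_ge0 ?exprn_ge0// gerBl exprn_ge0.
  elim: d => [|d IH].
    by rewrite expr0 !subrr nrm0 mulr0 mul0r.
  apply: (le_trans (nrm_distD (u (d + m)%N) _ _)).
  have := hu (d + m)%N; rewrite nrmB addSn => /(lerD IH)/le_trans; apply.
  by rewrite exprD exprS le_eqVlt; apply/orP; left; apply/eqP; field; lra.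
have rlim (e : R) : 0 < e ->
    exists N, forall m, (N <= m)%N -> c * r ^+ m / (1 - r) < e.
  move=> /(expr_lt_eventually (c / (1 - r)) r01)[N hN]; exists N => m /hN.
  by rewrite mulrAC.
have ucvg : cvg (u @ \oo).
  apply: cauchy_cvg; apply/cauchyP => e e0.
  have ee : e = (complex.Re e)%:C by rewrite RRe_real// gtr0_real.
  have [|N hN] := rlim (complex.Re e); first by rewrite -ltcR -ee.
  exists (u N); exists N => // m /= Nm.
  rewrite -ball_normE /ball_ /= nrmE ee ltcR -(subnK Nm).
  exact: le_lt_trans (step _ _) (hN _ (leqnn N)).
exists (lim (u @ \oo)) => m; apply/ler_addgt0Pr => e e0.
have eC0 : 0 < e%:C by rewrite ltcR.
move/cvgrPdist_lt : ucvg => /(_ _ eC0)[N _ /(_ (N + m)%N)/= hN].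
have {}hN := hN (leq_addr _ _); rewrite nrmE ltcR nrmB in hN.
have {hN} := ltW hN.
move/(lerD (step m N)); exact/le_trans/nrm_distD.
Qed.

Lemma nrm_small_eq0 x : (forall e : R, 0 < e -> nrm x <= e) -> x = 0.
Proof.
move=> h; apply: nrm0_eq0; apply/eqP; rewrite eq_le nrm_ge0 andbT.
by apply/ler_addgt0Pr => e e0; rewrite add0r h.
Qed.

End CStarNorm.

(** * Algebraic rules for *-homomorphisms *)

Section StarHom.
Variables (R : realType) (D E : cstarAlgType R) (f : D -> E).
Hypothesis hf : star_hom f.
Implicit Types (x y : D) (k : R[i]).

Let flin : linear f. Proof. by case: hf. Qed.
Lemma star_homM x y : f (x ** y) = f x ** f y.
Proof. by case: hf. Qed.
Lemma star_hom_star x : f (cstar x) = cstar (f x).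
Proof. by case: hf. Qed.
Lemma star_homD x y : f (x + y) = f x + f y.
Proof. by rewrite -[x]scale1r flin !scale1r. Qed.
Lemma star_hom0 : f 0 = 0.
Proof. by apply: (addrI (f 0)); rewrite -star_homD !addr0. Qed.
Lemma star_homZ k x : f (k *: x) = k *: f x.
Proof. by rewrite -[k *: x]addr0 flin star_hom0 addr0. Qed.
Lemma star_homN x : f (- x) = - f x.
Proof. by rewrite -scaleN1r star_homZ scaleN1r. Qed.
Lemma star_homB x y : f (x - y) = f x - f y.
Proof. by rewrite star_homD star_homN. Qed.
Lemma star_hom_sum (I : Type) (r : seq I) (F : I -> D) :
  f (\sum_(l <- r) F l) = \sum_(l <- r) f (F l).
Proof. exact: (big_morph f star_homD star_hom0). Qed.

Lemma star_hom_projection p : is_projection p -> is_projection (f p).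
Proof. by case=> ps pp; split; rewrite -?star_hom_star -?star_homM ?ps ?pp. Qed.

Lemma star_hom_span x : projection_span x -> projection_span (f x).
Proof.
move=> [m [c [p [pp ->]]]]; exists m, c, (f \o p); split=> [l|].
  exact: star_hom_projection.
by rewrite star_hom_sum; apply: eq_bigr => l _; rewrite star_homZ.
Qed.

End StarHom.

Lemma star_hom_comp (R : realType) (D E F : cstarAlgType R)
    (f : D -> E) (g : E -> F) : star_hom f -> star_hom g -> star_hom (g \o f).
Proof.
move=> hf hg; split=> [k x y|x y|x] /=.
- by rewrite (star_homD hf) (star_homZ hf) (star_homD hg) (star_homZ hg).
- by rewrite (star_homM hf) (star_homM hg).
- by rewrite (star_hom_star hf) (star_hom_star hg).
Qed.

(** * Contractivity of *-homomorphisms into sums of matrix algebras *)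

(** The equation is [(1 + c)(1 - d) = 1] with the unit cancelled; [c] is the Neumann series
    [d + d^2 + ...], obtained as the limit of the iterates of [c |-> d + c d]. *)
Lemma right_quasi_inverse (R : realType) (D : cstarAlgType R) (d : D) :
  nrm d < 1 -> exists c, c = d + c ** d.
Proof.
move=> d1; pose u m := iter m (fun c => d + c ** d) 0.
have d01 : 0 <= nrm d < 1 by rewrite nrm_ge0.
have [|l hl] := @geometric_limit _ _ u (nrm d) (nrm d) d01.
  elim=> [|m IH]; first by rewrite expr0 mulr1 /u /= cmul0l addr0 subr0.
  have -> : u m.+2 - u m.+1 = (u m.+1 - u m) ** d.
    by rewrite /u /= cmulBl opprD addrACA subrr add0r.
  by rewrite exprSr mulrA (le_trans (nrmM _ _))// ler_wpM2r ?nrm_ge0.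
exists l; apply/eqP; rewrite -subr_eq0; apply/eqP/nrm_small_eq0 => e e0.
(* The factor 2 counts two errors, of [u N.+1] against [l] and of [u N ** d] against [l ** d], each
   at most [nrm d ^+ (N + 2) / (1 - nrm d)]. *)
have [N hN] := expr_lt_eventually (2 * nrm d ^+ 2 / (1 - nrm d)) d01 e0.
apply: le_trans (ltW (hN N (leqnn N))).
apply: (le_trans (nrm_distD (u N.+1) _ _)).
have -> : u N.+1 - (d + l ** d) = (u N - l) ** d.
  by rewrite /u /= cmulBl opprD addrACA subrr add0r.
rewrite nrmB; apply: (le_trans (lerD (hl _) (nrmM _ _))).
apply: (le_trans (lerD (lexx _) (ler_wpM2r (nrm_ge0 d) (hl N)))).
by rewrite exprS le_eqVlt; apply/orP; left; apply/eqP; field; lra.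
Qed.

Section MatrixEstimate.
Variables (R : realType) (n : nat).
Implicit Types (u v w : 'cV[R[i]]_n) (M K : 'M[R[i]]_n).

Lemma dotBl u v w : dot (u - v) w = dot u w - dot v w.
Proof.
by rewrite /dot -sumrB; apply: eq_bigr => i _; rewrite !mxE rmorphB mulrBl.
Qed.
Lemma dotBr u v w : dot w (u - v) = dot w u - dot w v.
Proof. by rewrite /dot -sumrB; apply: eq_bigr => i _; rewrite !mxE mulrBr. Qed.
Lemma dotZr k u v : dot u (k *: v) = k * dot u v.
Proof. by rewrite /dot mulr_sumr; apply: eq_bigr => i _; rewrite mxE mulrCA. Qed.
Lemma dotC u v : dot u v = (dot v u)^*.
Proof.
rewrite /dot rmorph_sum; apply: eq_bigr => i _ /=.
by rewrite rmorphM /= conjcK mulrC.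
Qed.

(** Moving [adjm M] across the inner product turns both cross terms into
    [c * l2norm (M *m v) ^+ 2]. *)
Lemma l2norm_dist_sqr M (c : R) v :
  l2norm (v - c%:C *: (adjm M *m M *m v)) ^+ 2 =
  l2norm v ^+ 2 - 2 * c * l2norm (M *m v) ^+ 2
    + l2norm (c%:C *: (adjm M *m M *m v)) ^+ 2.
Proof.
set w := _ *: _; have vw : dot v w = (c * l2norm (M *m v) ^+ 2)%:C.
  by rewrite dotZr -mulmxA dot_adj dotvv -rmorphM.
have wv : dot w v = (c * l2norm (M *m v) ^+ 2)%:C.
  by rewrite dotC vw conjc_real.
apply: complexI; rewrite -dotvv dotBl !dotBr vw wv !dotvv !rmorphD !rmorphN /=.
rewrite -mulrA mulr_natl mulr2n rmorphD; ring.
Qed.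

(** A vector on which [M] almost attains its norm is almost fixed by the
    positive matrix [H := adjm M *m M] rescaled to norm [1], which the equation
    [K = H + K *m H], saying that [1 - H] has inverse [1 + K], forbids. *)
Lemma opnorm_no_quasi_inverse M K : 0 < opnorm M ->
  K <> (opnorm M ^- 2)%:C *: (adjm M *m M)
       + K *m ((opnorm M ^- 2)%:C *: (adjm M *m M)).
Proof.
set lam := opnorm M => lam0; set c := lam ^- 2; set H := _ *: (_ *m _) => KH.
have c0 : 0 < c by rewrite invr_gt0 exprn_gt0.
have lamc : lam ^+ 2 * c = 1 by rewrite mulfV// gt_eqF ?exprn_gt0.
have nc : normc c%:C = c by rewrite normc_realE gtr0_norm.
have Hle v : l2norm (H *m v) <= l2norm v.
  rewrite /H -scalemxAl l2normZ nc -mulmxA.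
  rewrite (le_trans (ler_wpM2l (ltW c0) (opnormP _ _)))//.
  rewrite (le_trans (ler_wpM2l (ltW c0) (ler_wpM2r (l2norm_ge0 _) (opnorm_adj_le _))))//.
  rewrite (le_trans (ler_wpM2l (ltW c0) (ler_wpM2l (ltW lam0) (opnormP _ _))))//.
  by rewrite -/lam (mulrA lam) -expr2 mulrA (mulrC c) lamc mul1r.
(* [1 + K] is a left inverse of [1 - H], so [k] controls [v] by [v - H *m v]. *)
pose k := 1 + opnorm K; have k1 : 1 <= k by rewrite lerDl opnorm_ge0.
have vle v : l2norm v <= k * l2norm (v - H *m v).
  have e : H *m v = K *m (v - H *m v).
    rewrite mulmxBr mulmxA; apply/eqP; rewrite eq_sym subr_eq -mulmxDl; apply/eqP.
    by congr (_ *m _).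
  rewrite -{1}(subrK (H *m v) v) (le_trans (l2normD _ _))//.
  by rewrite mulrDl mul1r lerD2l {1}e opnormP.
(* From [|v|^2 <= k^2 |v - Hv|^2 <= k^2 (2 |v|^2 - 2 c |Mv|^2)] follows [c |Mv|^2 <= t |v|^2]. As
   [t < 1], the norm of [M] would be smaller than itself. *)
pose t := 1 - (2 * k ^+ 2)^-1.
have k20 : 0 < 2 * k ^+ 2 by rewrite mulr_gt0// exprn_gt0//; lra.
have t1 : t < 1 by rewrite gtrBl invr_gt0.
have t0 : 0 <= t by rewrite subr_ge0 invf_le1//; nra.
have Mle v : l2norm (M *m v) <= lam * Num.sqrt t * l2norm v.
  rewrite -(@ler_pXn2r _ 2)// ?nnegrE ?mulr_ge0 ?sqrtr_ge0 ?l2norm_ge0 ?(ltW lam0)//.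
  rewrite !exprMn (sqr_sqrtr t0).
  have h1 : l2norm v ^+ 2 <= k ^+ 2 * l2norm (v - H *m v) ^+ 2.
    by rewrite -exprMn ler_pXn2r ?nnegrE ?l2norm_ge0 ?vle// mulr_ge0 ?l2norm_ge0//; lra.
  have h2 : l2norm (H *m v) ^+ 2 <= l2norm v ^+ 2.
    by rewrite ler_pXn2r ?nnegrE ?l2norm_ge0 ?Hle.
  have := l2norm_dist_sqr M c v; rewrite scalemxAl -/H => h3.
  move: h1 h2; rewrite h3.
  set V := l2norm v ^+ 2; set W := l2norm (M *m v) ^+ 2.
  set Z := l2norm (H *m v) ^+ 2 => h1 h2.
  suff : c * W <= t * V.
    move/(ler_wpM2l (exprn_ge0 2 (ltW lam0))); rewrite mulrA lamc mul1r mulrA//.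
  have h4 : V <= k ^+ 2 * (2 * V - 2 * c * W).
    by apply: le_trans h1 _; rewrite ler_wpM2l ?sqr_ge0//; lra.
  have h5 : V / (2 * k ^+ 2) <= V - c * W.
    rewrite ler_pdivrMr//; lra.
  rewrite /t mulrBl mul1r; lra.
have : lam <= lam * Num.sqrt t.
  by apply: opnorm_le Mle; rewrite mulr_ge0 ?sqrtr_ge0 ?ltW.
rewrite leNgt gtr_pMr// => /negP; apply.
by rewrite -sqrtr1 ltr_sqrt.
Qed.

End MatrixEstimate.

Lemma star_hom_contractive (R : realType) (D : cstarAlgType R)
    (k : nat) (n : 'I_k -> nat) (X : 'I_k -> compactHausdorff)
    (f : D -> matrix_sum R n X) : star_hom f -> forall a, nrm (f a) <= nrm a.
Proof.
move=> hf a; rewrite [leLHS](_ : _ = msum_norm (f a))//.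
apply: msum_norm_le => [|t x]; first exact: nrm_ge0.
rewrite leNgt; apply/negP => aM; set M := fiber _ _ in aM.
have M0 : 0 < opnorm M by apply: le_lt_trans aM; exact: nrm_ge0.
(* By [aM] this has norm below 1, so its quasi-inverse exists and is carried to the fibre at [x]. *)
pose d := (opnorm M ^- 2)%:C *: (cstar a ** a).
have [|c hc] := @right_quasi_inverse _ _ d.
  rewrite nrmZ nrm_starM normc_realE ger0_norm; last first.
    by rewrite invr_ge0 exprn_ge0// ltW.
  by rewrite mulrC ltr_pdivrMr ?exprn_gt0// mul1r ltr_pXn2r ?nnegrE ?nrm_ge0 ?(ltW M0).
have fd : fiber (f d) x = (opnorm M ^- 2)%:C *: (adjm M *m M).
  rewrite (star_homZ hf) fiberZ (star_homM hf) (star_hom_star hf).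
  by rewrite -fiber_star -fiberM.
apply: (@opnorm_no_quasi_inverse _ _ M (fiber (f c) x) M0).
by rewrite {1}hc -fd (star_homD hf) (star_homM hf) fiberD -fiberM.
Qed.

(** * Projections near almost idempotent self-adjoint elements *)

Section Projections.
Variables (R : realType) (D : cstarAlgType R).
Implicit Types (b e p q x y : D) (z : R[i]).

Lemma nrm_projection p : is_projection p -> nrm p <= 1.
Proof.
move=> [ps pp]; have := nrm_starM p; rewrite ps pp => h.
by have := nrm_ge0 p; nra.
Qed.

Definition defect b := b ** b - b.

(** [newton b = 3 b^2 - 2 b^3] is Newton's iteration for the equation
    [b ** b = b]. *)
Definition newton b := b + (defect b - (b ** defect b) *+ 2).

Lemma sqr_defect b : b ** b = b + defect b.
Proof. by rewrite subrKC. Qed.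

Lemma defect_comm b : defect b ** b = b ** defect b.
Proof. by rewrite cmulBl cmulBr cmulA. Qed.

Lemma cstar_newton b : cstar b = b -> cstar (newton b) = newton b.
Proof.
move=> bs; have es : cstar (defect b) = defect b by rewrite cstarB cstarM bs.
by rewrite /newton cstarD cstarB cstarMn cstarM bs es defect_comm.
Qed.

(** There is no linear term in [e], whence the convergence. All factors are polynomials in [b] and
    commute, but [ring] does not apply to [cmul], so the products are reduced by hand through
    [c = b e]. *)
Lemma newton_defect b (e := defect b) :
  defect (newton b) = (e ** e ** e) *+ 4 - (e ** e) *+ 3.
Proof.
have bb : b ** b = b + e := sqr_defect b.
have eb : e ** b = b ** e := defect_comm b.
rewrite /newton -/e; clearbody e; set c := b ** e; set t := e - c *+ 2.
have bc : b ** c = c + e ** e by rewrite cmulA bb cmulDl.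
have cb : c ** b = b ** c by rewrite -cmulA eb.
have tb : t ** b = b ** t by rewrite cmulBl cmulBr cmulMnl cmulMnr eb cb.
have ec : e ** c = c ** e by rewrite cmulA eb.
have cc : c ** c = c ** e + e ** e ** e.
  by rewrite {1}/c -cmulA ec !cmulA bb cmulDl cmulDl.
have tt : t ** t = e ** e + (e ** e ** e) *+ 4.
  rewrite cmulBl !cmulBr !cmulMnl !cmulMnr ec cc -!mulrnA !mulrnDl.
  rewrite opprB (mulrnDr _ 2 2); set g := (c ** e) *+ 2.
  by rewrite -(addrA g g) (addrC g (g + _)) addrK addrA subrK.
have bt : b ** t = - (c + (e ** e) *+ 2).
  by rewrite cmulBr cmulMnr bc mulrnDl -/c mulr2n !opprD !addrA subrr add0r.
rewrite /defect cmulDl [b ** _]cmulDr [t ** _]cmulDr tb tt bt bb.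
have -> : b + t = b + e - c *+ 2 by rewrite addrA.
move: (b + e) (e ** e) (e ** e ** e *+ 4) => x e2 e3; set y := - _.
have -> : x + y + (y + (e2 + e3)) - (x - c *+ 2) =
    c *+ 2 + (y + y + (e2 + e3)).
  by rewrite opprB [LHS]addrC -[x + y + _]addrA addrA subrK -[y + y + _]addrA.
rewrite -opprD -mulr2n mulrnDl -mulrnA opprD !addrA subrr add0r.
by rewrite (mulrSr e2 3) opprD subrK addrC.
Qed.

(** While [|e| <= 1/16], [4 |e|^3 + 3 |e|^2 <= |e| / 4], so the defect shrinks by a factor 4 at each
    Newton step. The steps form a geometric series of total length [(4/3) * 5 d <= 8 d]. *)
Lemma projection_near b : cstar b = b -> nrm (defect b) <= 16^-1 ->
  exists2 q, is_projection q & nrm (b - q) <= 8 * nrm (defect b).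
Proof.
move=> bs hb; set d := nrm (defect b) in hb *.
(* Here [|x|^2 = |x^2| <= |x| + 1], which forces [|x| <= 2]. *)
have bound x : cstar x = x -> nrm (defect x) <= 1 -> nrm x <= 2.
  move=> xs hx; have := nrm_starM x; rewrite xs => h.
  have : nrm (x ** x) <= nrm x + nrm (defect x).
    exact: nrm_le_dist.
  by have := nrm_ge0 x; nra.
pose u m := iter m newton b.
have us m : cstar (u m) = u m by elim: m => [//|m IH]; apply: cstar_newton.
have d0 : 0 <= d := nrm_ge0 _.
have r0m m : 0 <= (4^-1 : R) ^+ m <= 1.
  by rewrite exprn_ge0 ?exprn_ile1//=; lra.
have ud m : nrm (defect (u m)) <= d * (4^-1) ^+ m.
  elim: m => [|m IH]; first by rewrite expr0 mulr1.
  have dm : nrm (defect (u m)) <= 16^-1.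
    apply: le_trans IH _; apply: le_trans hb.
    by rewrite ler_piMr//; case/andP: (r0m m).
  rewrite [u _]/= newton_defect; set e := defect (u m) in dm IH *.
  have e0 := nrm_ge0 e.
  have e2 : nrm (e ** e) <= nrm e * nrm e by exact: nrmM.
  have e3 : nrm (e ** e ** e) <= nrm e * nrm e * nrm e.
    by apply: le_trans (nrmM _ _) _; rewrite ler_wpM2r.
  apply: (@le_trans _ _ (nrm e / 4)); last first.
    rewrite exprSr mulrA; lra.
  apply: le_trans (nrmD _ _) _; rewrite nrmN.
  apply: le_trans (lerD (nrm_muln _ _) (nrm_muln _ _)) _.
  rewrite -(mulr_natl _ 4) -(mulr_natl _ 3).
  have : nrm e * nrm e <= nrm e / 16 by rewrite ler_wpM2l.
  have : nrm e * nrm e * nrm e <= nrm e * nrm e / 16 by rewrite ler_wpM2l ?mulr_ge0.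
  lra.
have ud1 m : nrm (defect (u m)) <= 1.
  by apply: le_trans (ud m) _; have := r0m m; nra.
have r01 : 0 <= (4^-1 : R) < 1 by lra.
(* A Newton step has length at most [|e| + 2 |u m| |e| <= 5 |e|]. *)
have [|q hq] := @geometric_limit _ _ u (5 * d) 4^-1 r01.
  move=> m; rewrite [u m.+1]/= /newton addrC addKr -/(u m); set e := defect (u m).
  apply: le_trans (nrmD _ _) _; rewrite nrmN.
  apply: le_trans (lerD (lexx _) (nrm_muln _ _)) _.
  have h1 := ud m; have h2 := bound _ (us m) (ud1 m); have h3 := nrmM (u m) e.
  rewrite -(mulr_natl _ 2) -[leRHS]mulrA; rewrite -/e in h1.
  have : nrm (u m) * nrm e <= 2 * nrm e by rewrite ler_wpM2r ?nrm_ge0.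
  lra.
have c34 : (1 - 4^-1 : R)^-1 = 4 / 3 by field.
rewrite {}c34 in hq.
have qlim (c e : R) : 0 < e -> exists m, c * (4^-1) ^+ m < e.
  by move=> /(expr_lt_eventually c r01)[N hN]; exists N; exact: hN (leqnn N).
exists q; last first.
  by apply: le_trans (hq 0) _; rewrite expr0 mulr1; lra.
split.
  apply/eqP; rewrite -subr_eq0; apply/eqP/nrm_small_eq0 => e e0.
  have [m hm] := qlim (2 * (5 * d * (4 / 3))) e e0.
  apply: le_trans (ltW hm); apply: le_trans (nrm_distD (u m) _ _) _.
  rewrite -{1}(us m) -cstarB nrm_star nrmB; have := hq m; lra.
have q2 : nrm q <= 2 + 5 * d * (4 / 3).
  apply: le_trans (nrm_le_dist (u 0) q) _; rewrite nrmB.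
  by apply: lerD (bound _ (us 0) (ud1 0)) _; have := hq 0; rewrite expr0 mulr1.
apply/eqP; rewrite -subr_eq0; apply/eqP/nrm_small_eq0 => e e0.
set K := 5 * d * (4 / 3) in q2.
(* The summands bound, up to the factor [4^-m], the four terms of the decomposition of [q ** q - q]
   below. *)
have [m hm] := qlim ((2 + K) * K + K * 2 + d + K) e e0.
apply: le_trans (ltW hm).
have -> : q ** q - q =
    (q ** (q - u m) + (q - u m) ** u m) + (defect (u m) + (u m - q)).
  rewrite cmulBr cmulBl /defect [X in _ = X + _]addrA subrK.
  by rewrite [X in _ = _ + X]addrA subrK addrA subrK.
have hqm : nrm (q - u m) <= K * 4^-1 ^+ m by rewrite nrmB (le_trans (hq m))// mulrAC.
have K0 : 0 <= K * 4^-1 ^+ m by apply: le_trans hqm; exact: nrm_ge0.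
have h1 : nrm (q ** (q - u m)) <= (2 + K) * (K * 4^-1 ^+ m).
  by apply: le_trans (nrmM _ _) _; rewrite ler_pM ?nrm_ge0.
have h2 : nrm ((q - u m) ** u m) <= (K * 4^-1 ^+ m) * 2.
  by apply: le_trans (nrmM _ _) _; rewrite ler_pM ?nrm_ge0// bound.
have h3 := ud m; have h4 : nrm (u m - q) <= K * 4^-1 ^+ m by rewrite nrmB.
apply: le_trans (nrmD _ _) _; apply: le_trans (lerD (nrmD _ _) (nrmD _ _)) _.
lra.
Qed.

End Projections.

(** * The span of the projections, its closure, and commutators *)

Section Span.
Variables (R : realType) (D : cstarAlgType R).
Implicit Types (p q w x y : D) (k z : R[i]).
Local Notation span := (@projection_span R D).

Definition commutator x y := x ** y - y ** x.

Lemma span_projection p : is_projection p -> span p.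
Proof.
move=> hp; exists 1%N, (fun=> 1), (fun=> p); split=> //.
by rewrite big_ord1 scale1r.
Qed.

Lemma span0 : span 0.
Proof. by exists 0%N, (fun=> 0), (fun=> 0); split=> [[]|]; rewrite ?big_ord0. Qed.

Lemma spanD x y : span x -> span y -> span (x + y).
Proof.
move=> [m1 [c1 [p1 [hp1 ->]]]] [m2 [c2 [p2 [hp2 ->]]]].
exists (m1 + m2)%N.
exists (fun l => match fintype.split l with inl i => c1 i | inr i => c2 i end).
exists (fun l => match fintype.split l with inl i => p1 i | inr i => p2 i end); split.
  by move=> l; case: (fintype.split l).
by rewrite big_split_ord /=; congr (_ + _); apply: eq_bigr => i _;
  [rewrite (unsplitK (inl i))|rewrite (unsplitK (inr i))].
Qed.

Lemma spanZ k x : span x -> span (k *: x).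
Proof.
move=> [m [c [p [hp ->]]]]; exists m, (fun l => k * c l), p; split=> //.
by rewrite scaler_sumr; apply: eq_bigr => l _; rewrite scalerA.
Qed.

Lemma spanB x y : span x -> span y -> span (x - y).
Proof. by move=> hx hy; rewrite -scaleN1r; apply/spanD/spanZ. Qed.

Lemma span_sum (I : Type) (r : seq I) (F : I -> D) :
  (forall l, span (F l)) -> span (\sum_(l <- r) F l).
Proof.
by move=> h; elim/big_ind: _ => // [|x y]; [exact: span0|exact: spanD].
Qed.

Lemma commutator_sumr x (I : Type) (r : seq I) (c : I -> R[i]) (F : I -> D) :
  commutator x (\sum_(l <- r) c l *: F l) =
  \sum_(l <- r) c l *: commutator x (F l).
Proof.
elim/big_rec2: _ => [|l y1 y2 _ h].
  by rewrite /commutator cmul0l cmul0r subrr.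
rewrite -h /commutator cmulDl cmulDr cmulZl cmulZr scalerBr.
by rewrite opprD addrACA.
Qed.

Lemma commutatorC x y : commutator x y = - commutator y x.
Proof. by rewrite /commutator opprB. Qed.

(** For a complex number [z] with [|1 + z| = 1] the element [1 + z q] is unitary
    in the unitization, and this is the conjugate of [p] by it. *)
Definition rotate z q p :=
  p + z *: (q ** p) + z^* *: ((p + z *: (q ** p)) ** q).

Lemma rotate_projection z q p : z + z^* + z * z^* = 0 ->
  is_projection q -> is_projection p -> is_projection (rotate z q p).
Proof.
move=> hz [qs qq] [ps pp].
(* [U] is left multiplication by [1 + z q] and [V] right multiplication by its adjoint. [VU]
   expresses unitarity, where [hz] is used. *)
pose U x := x + z *: (q ** x); pose V x := x + z^* *: (x ** q).
have rE x : rotate z q x = V (U x) by [].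
have UV x : U (V x) = V (U x).
  rewrite /U /V cmulDr cmulDl cmulZl cmulZr !scalerDr !scalerA cmulA.
  by rewrite (mulrC z) addrACA.
have VU x y : V x ** U y = x ** y.
  rewrite /U /V cmulDl !cmulDr !cmulZl !cmulZr -!cmulA [q ** (q ** y)]cmulA qq.
  rewrite scalerA -!addrA -!scalerDl [z + _]addrA (mulrC z^*%R) hz scale0r addr0.
  by [].
have UM x y : U x ** y = U (x ** y) by rewrite /U cmulDl cmulZl cmulA.
have MV x y : x ** V y = V (x ** y) by rewrite /V cmulDr cmulZr cmulA.
split; rewrite rE.
  have -> : cstar (V (U p)) = U (cstar (U p)).
    by rewrite {1}/V cstarD cstarZ cstarM qs conjCK.
  have -> : cstar (U p) = V p by rewrite /U cstarD cstarZ cstarM qs ps.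
  exact: UV.
by rewrite -{2}UV VU UM MV pp UV.
Qed.

(** With [1 + z = i], conjugation gives [p + z q p + z^* p q + |z|^2 q p q]. Subtracting the same
    expression for [z^*] cancels the outer terms and leaves [2 i (q p - p q)]. *)
Lemma commutator_projection p q :
  is_projection p -> is_projection q -> span (commutator q p).
Proof.
move=> hp hq; pose z : R[i] := 'i%R - 1.
have zc : z^*%R = - 'i%R - 1.
  by rewrite rmorphB rmorph1; congr (_ - 1); exact: conjCi.
have h1 : z + z^* + z * z^* = 0.
  by rewrite zc /z; have := @sqrCi R[i]; rewrite expr2 => h; ring: h.
have h2 : z^* + z^*^* + z^* * z^*^* = 0.
  by rewrite conjCK (addrC _ z) (mulrC _ z).
suff -> : commutator q p = (2 * 'i%R)^-1 *: (rotate z q p - rotate z^*%R q p).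
  by apply/spanZ/spanB; apply/span_projection/rotate_projection.
have e (x a b c d y : D) :
    x + a + (c + y) - (x + b + (d + y)) = (a - b) + (c - d).
  by rewrite opprD addrACA; congr (_ + _);
    rewrite opprD addrACA subrr ?add0r ?addr0.
have -> : rotate z q p - rotate z^*%R q p = (2 * 'i%R) *: commutator q p.
  have zz : z - z^*%R = 2 * 'i%R by rewrite zc /z; ring.
  rewrite /rotate conjCK !cmulDl !cmulZl !scalerDr !scalerA (mulrC z) e.
  by rewrite -!scalerBl -[z^*%R - z]opprB zz scaleNr scalerN.
by rewrite scalerK// mulf_neq0 ?neq0Ci ?pnatr_eq0.
Qed.

Lemma span_commutator x y : span x -> span y -> span (commutator x y).
Proof.
move=> [m1 [c1 [p1 [hp1 ->]]]] [m2 [c2 [p2 [hp2 ->]]]].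
rewrite commutator_sumr; apply: span_sum => l; apply: spanZ.
rewrite commutatorC -scaleN1r; apply: spanZ.
rewrite commutator_sumr; apply: span_sum => l'; apply: spanZ.
exact: commutator_projection.
Qed.

Lemma L_span x : span x -> L D x.
Proof. exact: subset_closure. Qed.

Lemma L_commutator x y : span x -> L D y -> L D (commutator x y).
Proof.
move=> hx /closure_nrmP hy; apply/closure_nrmP => e e0.
(* The commutator with [x] has norm at most [2 * nrm x]; adding 1 permits division even if
   [x = 0]. *)
have k0 : 0 < 2 * nrm x + 1 by rewrite ltr_wpDl// mulr_ge0 ?nrm_ge0.
have [y' sy' yy'] := hy _ (divr_gt0 e0 k0).
exists (commutator x y'); first exact: span_commutator.
have -> : commutator x y - commutator x y' = x ** (y - y') - (y - y') ** x.
  by rewrite /commutator cmulBl cmulBr !opprB addrACA [RHS]addrACA (addrC (- _)).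
apply: le_lt_trans (nrmD _ _) _; rewrite nrmN.
apply: le_lt_trans (lerD (nrmM _ _) (nrmM _ _)) _.
have n0 := nrm_ge0 (y - y'); move: yy'; rewrite ltr_pdivlMr// => yy'; nra.
Qed.

Lemma LD x y : L D x -> L D y -> L D (x + y).
Proof.
move=> /closure_nrmP hx /closure_nrmP hy; apply/closure_nrmP => e e0.
have e20 : 0 < e / 2 by rewrite divr_gt0.
have [x' sx xx'] := hx _ e20; have [y' sy yy'] := hy _ e20.
exists (x' + y'); first exact: spanD.
rewrite opprD addrACA (le_lt_trans (nrmD _ _))//; lra.
Qed.

Lemma L_sum (I : Type) (r : seq I) (F : I -> D) :
  (forall l, L D (F l)) -> L D (\sum_(l <- r) F l).
Proof.
move=> h; elim/big_ind: _ => // [|x y]; [exact/L_span/span0|exact: LD].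
Qed.

Lemma L_limit x : (forall e : R, 0 < e -> exists2 y, L D y & nrm (x - y) < e) ->
  L D x.
Proof.
move=> h; have cl : closed (L D) by exact: closed_closure.
by apply: cl; apply/closure_nrmP.
Qed.

(** [w + w^*] and [i w - i w^*] are, up to sums of the projections [w w^*] and
    [w^* w], multiples of projections. *)
Lemma span_nilpotent_partial_isometry w :
  w ** cstar w ** w = w -> w ** w = 0 -> span w.
Proof.
pose h : R[i] := 2^-1.
have hh : 2 * h = 1 by rewrite mulfV// pnatr_eq0.
(* For the matrix unit [v = e_12] this is half of the all-ones 2 by 2 matrix. *)
have Q v : v ** cstar v ** v = v -> v ** v = 0 ->
    is_projection (h *: (v ** cstar v + cstar v ** v + v + cstar v)).
  move=> vvv vv; set vs := cstar v; set a := v ** vs; set b := vs ** v.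
  have vsvs : vs ** vs = 0 by rewrite -cstarM vv cstar0.
  have vsvvs : vs ** v ** vs = vs.
    by rewrite -[RHS](congr1 cstar vvv) !cstarM cstarK cmulA.
  have as_ : cstar a = a by rewrite cstarM cstarK.
  have bs : cstar b = b by rewrite cstarM cstarK.
  split.
    rewrite cstarZ !cstarD as_ bs cstarK -/vs -!addrA (addrC vs).
    by congr (_ *: _); rewrite fmorphV rmorph_nat.
  have row1 : a ** (a + b + v + vs) = a + v.
    rewrite !cmulDr /a /b !cmulA vvv -(cmulA v) vsvs cmul0r cmul0l.
    by rewrite !addr0.
  have row2 : b ** (a + b + v + vs) = b + vs.
    rewrite !cmulDr /a /b !cmulA vsvvs -!(cmulA vs v v) vv cmul0r cmul0l.
    by rewrite addr0 add0r.
  have row3 : v ** (a + b + v + vs) = v + a.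
    by rewrite !cmulDr /a /b !cmulA vv vvv cmul0l !addr0 add0r.
  have row4 : vs ** (a + b + v + vs) = vs + b.
    by rewrite !cmulDr /a /b !cmulA vsvs vsvvs cmul0l !addr0.
  set t := a + b + v + vs; have tt : t ** t = t *+ 2.
    rewrite {1}/t !cmulDl row1 row2 row3 row4 (addrC v a) (addrC vs b).
    have -> : t = a + v + (b + vs) by rewrite addrACA addrA.
    by rewrite mulr2n [RHS]addrA.
  rewrite cmulZl cmulZr scalerA tt -scaler_nat scalerA.
  by rewrite -mulrA (mulrC h 2) hh mulr1.
move=> vvv vv; set a := w ** cstar w; set b := cstar w ** w.
have ha : is_projection a by split; rewrite ?cstarM ?cstarK// /a cmulA vvv.
have hb : is_projection b.
  split; rewrite ?cstarM ?cstarK// /b cmulA -(cmulA _ w) -(cmulA (cstar w)).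
  by rewrite vvv.
pose j : R[i] := 'i%R.
have jj : j * j = -1 by rewrite -expr2 sqrCi.
have i0 : j * j^*%R = 1 by rewrite conjCi mulrN jj opprK.
(* Used for [w] and for [j *: w], which share the projections [a] and [b]. *)
have span1 v : v ** cstar v = a -> cstar v ** v = b -> v ** cstar v ** v = v ->
    v ** v = 0 -> span (v + cstar v).
  move=> va vb h1 h2.
  have -> : v + cstar v =
      2 *: (h *: (v ** cstar v + cstar v ** v + v + cstar v)) - a - b.
    rewrite scalerA hh scale1r va vb (addrC a b) -(addrA (b + a)).
    by rewrite (addrC (b + a)) addrA !addrK.
  by do 2?[apply: spanB; last exact: span_projection];
    apply/spanZ/span_projection/Q.
have iw1 : j *: w ** cstar (j *: w) = a.
  by rewrite cstarZ cmulZl cmulZr scalerA i0 scale1r.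
have iw2 : cstar (j *: w) ** (j *: w) = b.
  by rewrite cstarZ cmulZl cmulZr scalerA mulrC i0 scale1r.
have s1 : span (w + cstar w) by apply: span1.
have s2 : span (j *: w + cstar (j *: w)).
  apply: span1 => //; first by rewrite iw1 cmulZr vvv.
  by rewrite cmulZl cmulZr vv !scaler0.
have -> : w = h *: (w + cstar w - j *: (j *: w + cstar (j *: w))).
  rewrite cstarZ [j *: (_ + _)]scalerDr !scalerA i0 jj scaleN1r scale1r.
  rewrite opprD opprK addrACA subrr addr0 -mulr2n -scaler_nat scalerA.
  by rewrite mulrC hh scale1r.
by apply/spanZ/spanB => //; exact: spanZ.
Qed.

End Span.

(** * Matrix units in a sum of matrix algebras *)

Lemma scale_delta_mxE (K : pzRingType) (m p : nat) (f : K) (j a : 'I_m)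
    (l b : 'I_p) :
  (f *: delta_mx j l) a b = if (a == j) && (b == l) then f else 0.
Proof. by rewrite !mxE; case: (_ && _); rewrite ?mulr1 ?mulr0. Qed.

Section MatrixUnits.
Variables (R : realType) (k : nat) (n : 'I_k -> nat).
Variable X : 'I_k -> compactHausdorff.
Local Notation C := R[i].
Local Notation S := (matrix_sum R n X).
Local Notation CX t := (continuousType (X t) C).

Definition summand t (M : 'M[CX t]_(n t)) : S :=
  eqtype.dfwith (fun s => 0 : 'M[CX s]_(n s)) M.

Lemma summandM t (M N : 'M[CX t]_(n t)) :
  summand M ** summand N = summand (M *m N).
Proof.
apply: functional_extensionality_dep => s.
rewrite [LHS](_ : _ = summand M s *m summand N s)// /summand.
have [e|ts] := eqVneq t s; first by case: s / e; rewrite !dfwith_in.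
by rewrite !dfwith_out// mul0mx.
Qed.

Lemma summandB t (M N : 'M[CX t]_(n t)) :
  summand M - summand N = summand (M - N).
Proof.
apply: functional_extensionality_dep => s.
rewrite [LHS](_ : _ = summand M s - summand N s)// /summand.
have [e|ts] := eqVneq t s; first by case: s / e; rewrite !dfwith_in.
by rewrite !dfwith_out// subr0.
Qed.

Definition mx_unit t (j l : 'I_(n t)) (f : CX t) : S :=
  summand (f *: delta_mx j l).

Lemma mx_unit0 t (j l : 'I_(n t)) : mx_unit j l 0 = 0.
Proof.
rewrite /mx_unit scale0r -[X in summand X](subrr 0) -summandB subrr//.
Qed.

Lemma mx_unitM t (j l m p : 'I_(n t)) (f g : CX t) :
  mx_unit j l f ** mx_unit m p g = mx_unit j p ((f * g) *+ (l == m)).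
Proof.
rewrite summandM -scalemxAl -scalemxAr scalerA mul_delta_mx_cond /mx_unit.
by case: eqP => _; rewrite ?mulr1n// !mulr0n scaler0 scale0r.
Qed.

Lemma mx_unit_star t (j l : 'I_(n t)) :
  cstar (mx_unit j l 1) = mx_unit l j 1.
Proof.
apply: functional_extensionality_dep => s.
rewrite [LHS](_ : _ = msum_star (mx_unit j l 1) s)//.
apply/matrixP => a b; apply/continuousEP => x; rewrite msum_starE.
rewrite /mx_unit /summand; have [e|ts] := eqVneq t s; last first.
  by rewrite !dfwith_out// !mxE cts0E rmorph0.
subst s; rewrite !dfwith_in !scale_delta_mxE andbC.
by case: (_ && _); [exact: rmorph1|exact: rmorph0].
Qed.

Lemma sum_mx_unit (a : S) :
  a = \sum_t \sum_(j < n t) \sum_(l < n t) mx_unit j l (a t j l).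
Proof.
apply: functional_extensionality_dep => s.
have evs (I : Type) (r : seq I) (F : I -> S) :
    (\sum_(i <- r) F i) s = \sum_(i <- r) F i s.
  by apply: (big_morph (fun b : S => b s)).
rewrite evs (bigD1 s)//= [X in _ + X]big1 => [|t ts]; last first.
  rewrite evs big1// => j _; rewrite evs big1// => l _.
  by rewrite /mx_unit /summand dfwith_out.
rewrite addr0 evs [LHS]matrix_sum_delta; apply: eq_bigr => j _.
by rewrite evs; apply: eq_bigr => l _; rewrite /mx_unit /summand dfwith_in.
Qed.

Lemma corner_mx_unit t (f : CX t) (n0 : (0 < n t)%N) :
  corner n f = mx_unit (Ordinal n0) (Ordinal n0) f.
Proof.
congr (eqtype.dfwith _ _); apply/matrixP => i j.
by rewrite scale_delta_mxE mxE -!(inj_eq val_inj).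
Qed.

(** A diagonal unit is a projection; an off-diagonal one is a partial isometry of square zero. *)
Lemma span_mx_unit t (j l : 'I_(n t)) : @projection_span R S (mx_unit j l 1).
Proof.
have [<-|jl] := eqVneq j l.
  apply: span_projection; split; first exact: mx_unit_star.
  by rewrite mx_unitM eqxx mulr1.
apply: span_nilpotent_partial_isometry.
  by rewrite mx_unit_star !mx_unitM !eqxx !mulr1.
by rewrite mx_unitM eq_sym (negbTE jl) mulr0n mx_unit0.
Qed.

(** [f e_jl] is, up to a multiple of [f e_00], an iterated commutator of
    [f e_00] with the constant matrix units, which are in the span of the
    projections. *)
Lemma mx_unit_commutator_ind (P : set S) t (o : 'I_(n t)) (f : CX t) :
  (forall a b, P a -> P b -> P (a + b)) ->
  (forall a b, projection_span a -> P b -> P (commutator a b)) ->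
  P (mx_unit o o f) -> forall j l, P (mx_unit j l f).
Proof.
move=> PD Pc P00; have P0l l : P (mx_unit o l f).
  have [<-//|ol] := eqVneq o l.
  (* For [l != o] the product [e_ol e_oo] vanishes, so the commutator is [f e_ol]; the minus sign
     corrects the order. *)
  have := Pc (- mx_unit o l 1) (mx_unit o o f).
  rewrite /commutator cmulNl cmulNr opprK !mx_unitM eqxx mul1r mulr1.
  rewrite eq_sym (negbTE ol) mulr0n mx_unit0 oppr0 add0r; apply => //.
  by rewrite -scaleN1r; apply/spanZ/span_mx_unit.
move=> j l; have [<-//|oj] := eqVneq o j.
have := Pc _ _ (span_mx_unit j o) (P0l l).
rewrite /commutator !mx_unitM eqxx mul1r mulr1 mulr1n.
(* For [l = j] the commutator is [f e_jj - f e_oo], and [f e_oo] has to be added back. *)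
have [lj|lj] := eqVneq l j; last by rewrite mulr0n mx_unit0 subr0.
by rewrite mulr1n => /PD/(_ P00); rewrite subrK.
Qed.

End MatrixUnits.

(** * Approximation at finite stages of an inductive limit *)

Section InductiveLimit.
Variables (R : realType) (A : nat -> cstarAlgType R).
Variable phi : forall i, A i -> A i.+1.
Variables (B : cstarAlgType R) (psi : forall i, A i -> B).
Hypothesis phi_hom : forall i, star_hom (@phi i).
Hypothesis phi_contractive : forall i (a : A i), nrm (phi a) <= nrm a.
Hypothesis lim : is_inductive_limit phi psi.

Let psi_hom i : star_hom (@psi i). Proof. by case: lim. Qed.

Lemma connecting_hom i m : star_hom (@connecting A phi i m).
Proof.
elim: m => [|m IH]; first by [].
exact: (star_hom_comp IH (@phi_hom (m + i)%N)).
Qed.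

Lemma connecting_contractive i m (a : A i) : nrm (connecting phi m a) <= nrm a.
Proof. by elim: m => //= m; apply/le_trans/phi_contractive. Qed.

Lemma psi_connecting i m (a : A i) : psi (connecting phi m a) = psi a.
Proof. by have [_ h _ _] := lim; elim: m => //= m <-; exact: h. Qed.

(** Stated for a predicate because [m' + (m + i)] and [m' + m + i] are not
    convertible. *)
Lemma connecting_comp (P : forall j, A j -> Prop) i m m' (a : A i) :
  P (m' + (m + i))%N (connecting phi m' (connecting phi m a)) ->
  P (m' + m + i)%N (connecting phi (m' + m) a).
Proof. by elim: m' P => //= m' IH P; apply: (IH (fun j x => P j.+1 (phi x))). Qed.

Lemma nrm_psi_limit i (a : A i) (e : R) : 0 < e ->
  exists m, `|nrm (psi a) - nrm (connecting phi m a)| < e.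
Proof.
move=> e0; have eC0 : 0 < e%:C by rewrite ltcR.
have [_ _ /(_ i a)/cvgrPdist_lt/(_ _ eC0)[m _ hm] _] := lim.
exists m; have := hm m (leqnn m).
by rewrite /= !nrmE -rmorphB -Defs.normcE ltcR normc_realE.
Qed.

Lemma psi_contractive i (a : A i) : nrm (psi a) <= nrm a.
Proof.
apply/ler_addgt0Pr => e e0; have [m] := nrm_psi_limit a e0.
rewrite ltr_norml => /andP[_]; rewrite ltrBlDr => /ltW/le_trans; apply.
by rewrite addrC lerD2r connecting_contractive.
Qed.

Lemma connecting_small i (a : A i) (e : R) : nrm (psi a) < e ->
  exists m, nrm (connecting phi m a) < e.
Proof.
rewrite -subr_gt0 => /(nrm_psi_limit a)[m]; rewrite ltr_norml => /andP[h _].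
by exists m; lra.
Qed.

Lemma psi_dense (y : B) (e : R) : 0 < e ->
  exists i (a : A i), nrm (y - psi a) < e.
Proof.
have [_ _ _ d] := lim; have : [set: B] y by [].
rewrite -d => /closure_nrmP h /h[_ [i _ [a _ <-]] ya].
by exists i, a.
Qed.

(** Serves to bring projections found at different stages into one algebra. *)
Lemma push_projection i j (q : A i) : (i <= j)%N -> is_projection q ->
  exists2 q' : A j, is_projection q' & psi q' = psi q.
Proof.
move=> ij hq; rewrite -(subnK ij); exists (connecting phi (j - i) q).
  exact: (star_hom_projection (connecting_hom i (j - i))) hq.
exact: psi_connecting.
Qed.

Lemma lift_projection (p : B) (e : R) : is_projection p -> 0 < e ->
  exists i, exists2 q : A i, is_projection q & nrm (psi q - p) < e.
Proof.
(* The defect will be below [5 h]: the bound [1/80] makes this at most [1/16], and [e / 42] makes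
   the total error [8 * 5 h + h] less than [e]. *)
move=> hp e0; pose h := Num.min 80^-1 (e / 42).
have h0 : 0 < h by rewrite lt_min invr_gt0 divr_gt0// ltr0n.
have h80 : h <= 80^-1 by rewrite ge_min lexx.
have h42 : h <= e / 42 by rewrite ge_min lexx orbT.
have [i [b0 pb0]] := psi_dense p h0; have [ps pp] := hp.
(* Since [p] is self-adjoint, passing to the self-adjoint part does not increase the distance to
   it. *)
pose s : R[i] := 2^-1; pose b := s *: (b0 + cstar b0).
have bs : cstar b = b.
  rewrite cstarZ cstarD cstarK addrC; congr (_ *: _).
  by rewrite fmorphV rmorph_nat.
have bp : nrm (psi b - p) <= h.
  have -> : psi b - p = s *: ((psi b0 - p) + cstar (psi b0 - p)).
    rewrite (star_homZ (psi_hom i)) (star_homD (psi_hom i)) cstarB ps.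
    rewrite (star_hom_star (psi_hom i)) addrACA -opprD -mulr2n -scaler_nat.
    by rewrite scalerBr scalerA mulVf ?pnatr_eq0// scale1r.
  rewrite nrmZ; have -> : normc s = 2^-1.
    by apply: complexI; rewrite Defs.normcE normfV normr_nat fmorphV rmorph_nat.
  have := nrmD (psi b0 - p) (cstar (psi b0 - p)).
  by rewrite nrm_star nrmB; lra.
have nb : nrm (psi b) <= 2.
  by have := nrm_le_dist p (psi b); have := nrm_projection hp; lra.
have : nrm (psi (defect b)) < 5 * h.
  rewrite /defect (star_homB (psi_hom i)) (star_homM (psi_hom i)).
  have -> : psi b ** psi b - psi b =
      psi b ** (psi b - p) + (psi b - p) ** p + (p - psi b).
    by rewrite cmulBr cmulBl pp !subrKA.
  apply: le_lt_trans (nrmD _ _) _.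
  apply: le_lt_trans (lerD (nrmD _ _) (lexx _)) _.
  apply: le_lt_trans (lerD (lerD (nrmM _ _) (nrmM _ _)) (lexx _)) _.
  rewrite [nrm (p - _)]nrmB.
  have := nrm_projection hp; have := nrm_ge0 p; have := nrm_ge0 (psi b).
  have := nrm_ge0 (psi b - p); nra.
(* The defect is small only in the limit; at a later stage it is small in norm, and Newton's
   iteration applies there. *)
move=> /connecting_small[m]; set c := connecting phi m b.
have mhom := connecting_hom i m.
have -> : connecting phi m (defect b) = defect c.
  by rewrite /defect (star_homB mhom) (star_homM mhom).
move=> hc; have [||q hq cq] := @projection_near _ _ c.
- by rewrite -(star_hom_star mhom) bs.
- by lra.
exists (m + i)%N, q => //; apply: le_lt_trans (nrm_distD (psi c) _ _) _.
have := psi_contractive (q - c); rewrite (star_homB (psi_hom (m + i)%N)).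
have -> : psi c = psi b by exact: psi_connecting.
rewrite [nrm (q - c)]nrmB; lra.
Qed.

Lemma approx_span_of_LP : LP_property B -> forall i (a : A i) (e : R), 0 < e ->
  exists m, exists2 b, projection_span b & nrm (connecting phi m a - b) < e.
Proof.
move=> LP i a e e0; have e30 : 0 < e / 3 by rewrite divr_gt0.
have : L B (psi a) by rewrite LP.
move=> /closure_nrmP/(_ _ e30)[_ [M [c [p [hp ->]]]] ay].
(* The coefficients weight the lifting errors; the 1 keeps [K] positive if they all vanish. *)
pose K := 1 + \sum_l normc (c l).
have K0 : 0 < K by rewrite ltr_pwDl// sumr_ge0// => l _; exact: normc_ge0.
have /choice[s hs] (l : 'I_M) : exists s : {j & A j},
    is_projection (tagged s) /\ nrm (psi (tagged s) - p l) < e / 3 / K.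
  have [j [q hq qp]] := lift_projection (hp l) (divr_gt0 e30 K0).
  by exists (existT _ j q).
(* A sum bounds all its terms, so [J + i] lies beyond every stage used. *)
pose J := (\sum_l tag (s l))%N.
have /choice[q hq] (l : 'I_M) : exists q : A (J + i)%N,
    is_projection q /\ psi q = psi (tagged (s l)).
  have lJ : (tag (s l) <= J + i)%N.
    by rewrite /J (bigD1 l)//= -addnA leq_addr.
  have [q hq qs] := push_projection lJ (hs l).1.
  by exists q.
have pJ := psi_hom (J + i)%N.
pose x := \sum_l c l *: q l.
have : nrm (psi (connecting phi J a - x)) < e.
  rewrite (star_homB pJ) psi_connecting (star_hom_sum pJ).
  apply: le_lt_trans (nrm_distD (\sum_l c l *: p l) _ _) _.
  rewrite -sumrB.
  have : nrm (\sum_l (c l *: p l - psi (c l *: q l))) <= K * (e / 3 / K).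
    apply: le_trans (nrm_sum _ _) _; rewrite {1}/K mulrDl mul1r mulr_suml.
    rewrite ler_wpDl ?divr_ge0 ?(ltW K0) ?(ltW e0)//; apply: ler_sum => l _.
    rewrite (star_homZ pJ) -scalerBr nrmZ ler_wpM2l ?normc_ge0//.
    by rewrite nrmB (hq l).2 ltW// (hs l).2.
  by rewrite mulrC divfK ?gt_eqF//; lra.
move=> /connecting_small[m]; have mhom := connecting_hom (J + i)%N m.
rewrite (star_homB mhom).
have sx : projection_span (connecting phi m x).
  by apply: star_hom_span => //; exists M, c, q; split=> // l; case: (hq l).
pose P j (y : A j) := exists2 b, projection_span b & nrm (y - b) < e.
by exists (m + J)%N; apply: (@connecting_comp P); exists (connecting phi m x).
Qed.

Lemma L_psi i (x : A i) : L (A i) x -> L B (psi x).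
Proof.
move=> /closure_nrmP hx; apply/closure_nrmP => e /hx[y sy xy].
exists (psi y); first exact: star_hom_span.
by rewrite -(star_homB (psi_hom i)) (le_lt_trans (psi_contractive _)).
Qed.

(** The approximants from later stages all land in [L B], which is closed, while [psi] does not see
    the connecting maps. *)
Lemma L_psi_connecting i (a : A i) :
  (forall e : R, 0 < e ->
     exists m, exists2 b, L (A (m + i)%N) b & nrm (connecting phi m a - b) < e) ->
  L B (psi a).
Proof.
move=> h; apply: L_limit => e /h[m [b Lb ab]]; exists (psi b); first exact: L_psi.
rewrite -(psi_connecting m) -(star_homB (psi_hom _)).
exact: le_lt_trans (psi_contractive _) ab.
Qed.

End InductiveLimit.

(** * Equivalence of the LP property with approximability of corners *)

Theorem corollary2p1 (R : realType) (k : nat -> nat)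
    (n : forall i : nat, 'I_(k i) -> nat)
    (X : forall i : nat, 'I_(k i) -> compactHausdorff)
    (n_gt0 : forall (i : nat) (t : 'I_(k i)), (0 < n i t)%N)
    (X_connected : forall (i : nat) (t : 'I_(k i)), connected [set: X i t])
    (phi : forall i : nat,
       matrix_sum R (n i) (X i) -> matrix_sum R (n i.+1) (X i.+1))
    (phi_hom : forall i : nat, star_hom (phi i))
    (A : cstarAlgType R) (psi : forall i : nat, matrix_sum R (n i) (X i) -> A)
    (A_lim : @is_inductive_limit R (fun i : nat => matrix_sum R (n i) (X i))
               phi A psi) :
  LP_property A <->
  (forall (i : nat) (t : 'I_(k i)) (f : continuousType (X i t) R[i]) (e : R),
     0 < e ->
     exists (m : nat) (b : matrix_sum R (n (m + i)%N) (X (m + i)%N)),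
       L (matrix_sum R (n (m + i)%N) (X (m + i)%N)) b /\ `|connecting phi m (corner (n i) f) - b| < e%:C).
Proof.
have contr i (a : matrix_sum R (n i) (X i)) : nrm (phi i a) <= nrm a.
  exact: star_hom_contractive (phi_hom i) a.
pose S i : cstarAlgType R := matrix_sum R (n i) (X i).
split=> [LP i t f e e0|h].
  have [m [b sb ab]] := @approx_span_of_LP R S phi A psi phi_hom contr A_lim LP
    i (corner (n i) f) e e0.
  exists m, b; split; first exact: L_span.
  by rewrite nrmE ltcR.
have [psi_hom _ _ _] := A_lim.
apply/seteqP; split=> // y _; apply: L_limit => e e0.
have [i [a ya]] := @psi_dense R S phi A psi A_lim y e e0.
exists (psi i a) => //.
(* By density and closedness of [L A], only the images of single entries [f e_jl] remain. *)
rewrite (sum_mx_unit a) (star_hom_sum (psi_hom i)); apply: L_sum => t.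
rewrite (star_hom_sum (psi_hom i)); apply: L_sum => j.
rewrite (star_hom_sum (psi_hom i)); apply: L_sum => l.
(* [P] is taken in the limit because (ii) places corners in [L] only after they are mapped to [A];
   the homomorphism [psi i] carries the commutators along. *)
pose o := Ordinal (n_gt0 i t); pose P := [set x | L A (psi i x)].
apply: (@mx_unit_commutator_ind _ _ _ _ P t o) => [x x' hx hx'|x x' sx hx|].
- by rewrite /P /= (star_homD (psi_hom i)); apply: LD.
- rewrite /P /= /commutator (star_homB (psi_hom i)) !(star_homM (psi_hom i)).
  exact: L_commutator (star_hom_span (psi_hom i) sx) hx.
rewrite /P /= -corner_mx_unit.
apply: (@L_psi_connecting R S phi A psi contr A_lim i (corner (n i) (a t j l))) => d d0.
have [m [b [Lb ab]]] := h i t (a t j l) d d0.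
by exists m, b => //; rewrite -ltcR -nrmE.
Qed.
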